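(* Let $\varphi$ be an index function such that for every $\eta>0$ the quotient function $t\mapsto t^\eta/\varphi(t)$ is strictly increasing for sufficiently small $t>0$, and suppose that the source condition $u^\dagger-\bar u=\varphi(G)\,w$ holds for some $w\in X$. Set $\psi(\alpha):=\varphi(\alpha)\,\alpha^{a/(2a+2)}$ for $\alpha>0$ and $\alpha_*=\alpha(\delta):=\psi^{-1}(\delta)$. For every $\delta>0$ let $f^\delta\in Y$ satisfy $\|f^\delta-f^\dagger\|\le\delta$. Then $$\|u_{\alpha_*}^\delta-u^\dagger\|=\mathcal O\big(\varphi(\psi^{-1}(\delta))\big)\qquad\text{as }\delta\to0.$$
   Context: Setting. $X,Y$ are infinite-dimensional Hilbert spaces, norms $\|\cdot\|$. $B: X\supset \mathcal D(B)\to X$ is a self-adjoint, positive definite, unbounded linear operator with dense domain and $\|Bu\|\ge m\|u\|$ for all $u\in\mathcal D(B)$, for some constant $m>0$. For $\tau\in\mathbb R$ put $\|u\|_\tau:=\|B^\tau u\|$ for $u\in X_\tau$, where $X_\tau:=\mathcal D(B^\tau)$ for $\tau>0$ and $X_\tau:=X$ for $\tau\le 0$ (no completion is taken for $\tau<0$). Standing assumptions. $F: X\supset\mathcal D(F)\to Y$ is a (possibly nonlinear) operator such that: (a) $F$ is sequentially continuous on $\mathcal D(F)$ with respect to the weak topologies of $X$ and $Y$; (b) $\mathcal D(F)\subset X$ is closed and convex; (c) $\mathcal D:=\mathcal D(F)\cap X_1$ is non-empty, where $X_1=\mathcal D(B)$; (d) $u^\dagger\in\mathcal D(F)$ satisfies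 $F(u^\dagger)=f^\dagger$ and is an interior point of $\mathcal D(F)$ (it is not required that $u^\dagger\in X_1$); (e) the data $f^\delta\in Y$ satisfy $\|f^\delta-f^\dagger\|\le\delta$, and the initial guess $\bar u$ lies in $\mathcal D$; (f) there are $a>0$ and constants $0<c_a\le C_a<\infty$ with $$c_a\|u-u^\dagger\|_{-a}\le\|F(u)-f^\dagger\|\le C_a\|u-u^\dagger\|_{-a}\quad\text{for all }u\in\mathcal D.$$ Tikhonov regularization. For $\alpha>0$ let $T_\alpha^\delta(u):=\|F(u)-f^\delta\|^2+\alpha\|u-\bar u\|_1^2$, to be minimized over $u\in\mathcal D(F)$ (with $\|u-\bar u\|_1=+\infty$ if $u\notin X_1$, so minimizers lie in $\mathcal D$). Minimizers exist for each $\alpha>0$ but need not be unique; $u_\alpha^\delta\in\mathcal D$ denotes an arbitrary minimizer (regularized solution). Further notation. $G:=B^{-(2a+2)}:X\to X$, a bounded, injective, self-adjoint, positive semidefinite linear operator. An index function is a continuous, non-decreasing function $\varphi:(0,\infty)\to(0,\infty)$ with $\lim_{t\to0}\varphi(t)=0$. The operator $\varphi(G)$ is defined by the spectral calculus (with $\varphi(0):=0$). The function $\psi$ is a strictly increasing bijection of $(0,\infty)$ onto itself. *)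

(* Defs.v *)
From HB Require Import structures.
From mathcomp Require Import all_boot all_order all_algebra.
From mathcomp Require Import all_classical all_reals all_analysis.

Set Implicit Arguments.
Unset Strict Implicit.
Unset Printing Implicit Defensive.

Import Order.TTheory GRing.Theory Num.Theory.
Import numFieldNormedType.Exports.
Import HBSimple.

Local Open Scope classical_set_scope.
Local Open Scope ring_scope.

(* Real Hilbert spaces. A complex Hilbert space is one of these for the inner
   product Re <u, v>: the norm, the weak topology, self-adjointness of complex
   linear operators and their spectral measures are unchanged. *)
HB.mixin Record NormedModule_isHilbert (R : realType) X
    & CompleteNormedModule R X := {
  inner : X -> X -> R ;
  innerC : forall u v, inner u v = inner v u ;
  inner_linearl : forall (a : R) u v w,
    inner (a *: u + v) w = a * inner u w + inner v w ;
  inner_normE : forall u, inner u u = `|u| ^+ 2 }.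

#[short(type="hilbertType")]
HB.structure Definition Hilbert (R : realType) :=
  {X of NormedModule_isHilbert R X & CompleteNormedModule R X}.

Section hilbert.
Context {R : realType} {X : hilbertType R}.
Implicit Types (u v w : X).

Lemma inner_linearr (a : R) u v w :
  inner w (a *: u + v) = a * inner w u + inner w v.
Proof. by rewrite innerC inner_linearl !(innerC w). Qed.

Lemma innerDl u v w : inner (u + v) w = inner u w + inner v w.
Proof. by rewrite -[u in LHS]scale1r inner_linearl mul1r. Qed.

Lemma innerDr u v w : inner w (u + v) = inner w u + inner w v.
Proof. by rewrite !(innerC w) innerDl. Qed.

Lemma inner0l w : inner 0 w = 0.
Proof. by apply: (addrI (inner 0 w)); rewrite -innerDl !addr0. Qed.

Lemma inner0r w : inner w 0 = 0.
Proof. by rewrite innerC inner0l. Qed.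

Lemma normD_sqr u v : inner u v = 0 -> `|u + v| ^+ 2 = `|u| ^+ 2 + `|v| ^+ 2.
Proof.
move=> uv; rewrite -!inner_normE innerDl !innerDr (innerC v u) uv.
by rewrite addr0 add0r.
Qed.

Definition weak_cvg (x : nat -> X) (l : X) :=
  forall w, inner (x n) w @[n --> \oo] --> inner l w.

End hilbert.

Definition infinite_dim (R : realType) (X : lmodType R) :=
  forall n (x : 'I_n -> X), exists u,
    forall c : 'I_n -> R, u <> \sum_(i < n) c i *: x i.

Definition weak_seq_continuous (R : realType) (X Y : hilbertType R)
    (D : set X) (F : X -> Y) :=
  forall (x : nat -> X) (l : X), (forall n, D (x n)) -> D l ->
    weak_cvg x l -> weak_cvg (F \o x) (F l).

(* An unbounded operator is a pair of a domain D : set X and a map T : X -> X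
   whose values outside D are irrelevant. *)
Section unbounded_operators.
Context {R : realType} {X : hilbertType R}.
Variables (D : set X) (T : X -> X).

Definition linear_on :=
  D 0 /\ forall (a : R) u v, D u -> D v ->
    D (a *: u + v) /\ T (a *: u + v) = a *: T u + T v.

Definition densely_defined := closure D = setT.

(* The right-hand side of the equivalence is the graph of the adjoint. *)
Definition self_adjoint :=
  [/\ linear_on, densely_defined &
      forall u v, (D u /\ T u = v) <->
        (forall w, D w -> inner (T w) u = inner w v)].

Definition positive_definite :=
  forall u, D u -> u != 0 -> 0 < inner (T u) u.

Definition unbounded := ~ exists C : R, forall u, D u -> `|T u| <= C * `|u|.

End unbounded_operators.

(* Projection-valued Borel measures on the real line. *)
Record spectral_measure (R : realType) (X : hilbertType R) := SpectralMeasure {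
  sproj :> set (measurableTypeR R) -> X -> X ;
  sproj_linear : forall A, measurable A ->
    forall (a : R) u v, sproj A (a *: u + v) = a *: sproj A u + sproj A v ;
  sproj_sym : forall A, measurable A ->
    forall u v, inner (sproj A u) v = inner u (sproj A v) ;
  sprojI : forall A B, measurable A -> measurable B ->
    forall u, sproj (A `&` B) u = sproj A (sproj B u) ;
  sproj0 : forall u, sproj set0 u = 0 ;
  sprojT : forall u, sproj setT u = u ;
  sproj_sigma_additive : forall (A : nat -> set (measurableTypeR R)),
    (forall n, measurable (A n)) -> trivIset setT A ->
    forall u, (\sum_(0 <= i < n) sproj (A i) u) @[n --> \oo]
                --> sproj (\bigcup_n A n) u }.

Section spectral_calculus.
Context {R : realType} {X : hilbertType R}.
Variable E : spectral_measure X.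

(* A |-> <E A u, u> = |E A u|^2 *)
Definition smeasure (u : X) (A : set (measurableTypeR R)) : \bar R :=
  (`|E A u| ^+ 2)%:E.

Section smeasure_measure.
Variable u : X.

Let smeasure0 : smeasure u set0 = 0%E.
Proof. by rewrite /smeasure sproj0 normr0 expr0n. Qed.

Let smeasure_ge0 A : (0 <= smeasure u A)%E.
Proof. by rewrite lee_fin sqr_ge0. Qed.

Let smeasure_sum (A : nat -> set (measurableTypeR R)) :
  (forall n, measurable (A n)) -> trivIset setT A -> forall n,
  `|\sum_(0 <= i < n) E (A i) u| ^+ 2 = \sum_(0 <= i < n) `|E (A i) u| ^+ 2.
Proof.
move=> mA tA; elim=> [|n IHn]; first by rewrite !big_nil normr0 expr0n.
rewrite !big_nat_recr //= normD_sqr ?IHn //.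
rewrite [LHS](_ : _ = \sum_(0 <= i < n) inner (E (A i) u) (E (A n) u)).
  apply: big1_seq => i /andP[_]; rewrite mem_index_iota => /andP[_ ltin].
  rewrite sproj_sym // -sprojI //.
  have /trivIsetP/(_ i n I I) -> := tA; last by rewrite ltn_eqF.
  by rewrite sproj0 inner0r.
by apply: (big_morph (fun x => inner x (E (A n) u))) => [x y|];
  rewrite ?innerDl ?inner0l.
Qed.

Let smeasure_sigma_additive : semi_sigma_additive (smeasure u).
Proof.
move=> A mA tA _; rewrite [X in X @ _ --> _](_ : _ =
    EFin \o (fun n => `|\sum_(0 <= i < n) E (A i) u| ^+ 2)); last first.
  by apply/funext => n /=; rewrite smeasure_sum // sumEFin.
apply: cvg_EFin; first by near=> n.
rewrite /= (_ : _ \o _ = fun n => `|\sum_(0 <= i < n) E (A i) u| ^+ 2) //.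
rewrite expr2; under eq_fun do rewrite expr2.
by apply: cvgM; apply: cvg_norm; exact: sproj_sigma_additive.
Unshelve. all: by end_near. Qed.

HB.instance Definition _ := isMeasure.Build _ (measurableTypeR R) R
  (smeasure u) smeasure0 smeasure_ge0 smeasure_sigma_additive.

End smeasure_measure.

Definition sdom (f : R -> R) : set X :=
  [set u | (\int[smeasure u]_t ((f t) ^+ 2)%:E < +oo)%E].

Definition spectral_sint (s : {sfun measurableTypeR R >-> R}) (u : X) : X :=
  \sum_(y \in range s) y *: E (s @^-1` [set y]) u.

(* For Borel f the integral of f with respect to E at u is the limit of the
   integrals of simple functions that converge to f in L^2(smeasure u). *)
Definition is_spectral_int (f : R -> R) (u v : X) :=
  exists s : nat -> {sfun measurableTypeR R >-> R},
    (\int[smeasure u]_t ((s n t - f t) ^+ 2)%:E)%E @[n --> \oo] --> 0%E /\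
    spectral_sint (s n) u @[n --> \oo] --> v.

(* The limit exists exactly when u \in sdom f; it is 0 by default otherwise. *)
Definition spectral_int (f : R -> R) (u : X) : X :=
  xget 0 [set v | is_spectral_int f u v].

(* E is the spectral measure of the operator T with domain D, that is, T is the
   integral of the identity with respect to E. By the spectral theorem, a
   self-adjoint T has exactly one such E. *)
Definition spectral_measure_of (D : set X) (T : X -> X) :=
  D = sdom id /\ forall u, D u -> T u = spectral_int id u.

(* For E the spectral measure of a positive definite operator B, the powers
   B ^ tau; the values of powR at nonpositive reals play no role, since E
   vanishes there. *)
Definition spow (tau : R) : X -> X := spectral_int (fun t => t `^ tau).

Definition snorm (tau : R) (u : X) : R := `|spow tau u|.

Definition sspace (tau : R) : set X :=
  if 0 < tau then sdom (fun t => t `^ tau) else setT.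

End spectral_calculus.

Section tikhonov.
Context {R : realType} {X Y : hilbertType R}.
Variables (E : spectral_measure X) (F : X -> Y) (ubar : X).

Definition tikhonov (f : Y) (alpha : R) (u : X) : \bar R :=
  if u \in sspace E 1 then
    (`|F u - f| ^+ 2 + alpha * snorm E 1 (u - ubar) ^+ 2)%:E
  else +oo%E.

Definition tikhonov_minimizer (DF : set X) (f : Y) (alpha : R) (u : X) :=
  DF u /\ forall v, DF v -> (tikhonov f alpha u <= tikhonov f alpha v)%E.

End tikhonov.

Section index_functions.
Context {R : realType}.
Implicit Types phi : R -> R.

Definition index_function phi :=
  [/\ forall t : R, 0 < t -> 0 < phi t,
      forall t : R, 0 < t -> {for t, continuous phi},
      forall s t : R, 0 < s -> s <= t -> phi s <= phi t &
      phi t @[t --> 0^'+] --> 0].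

(* An index function extended by 0 outside ]0, +oo[. *)
Definition ext0 phi (t : R) : R := if 0 < t then phi t else 0.

Definition quotient_increasing phi := forall eta : R, 0 < eta ->
  exists2 t0 : R, 0 < t0 & forall s t : R, 0 < s -> s < t -> t < t0 ->
    s `^ eta / phi s < t `^ eta / phi t.

Definition psi (a : R) phi (alpha : R) : R :=
  phi alpha * alpha `^ (a / (2 * a + 2)).

Definition psi_inv (a : R) phi : R -> R :=
  'pinv_(fun=> 1) `]0, +oo[%classic (psi a phi).

End index_functions.

(* Main.v *)
Require Import Defs.
From HB Require Import structures.
From mathcomp Require Import all_boot all_order all_algebra finmap.
From mathcomp Require Import all_classical all_reals all_analysis.
From mathcomp Require Import measurable_realfun ring lra.

(** Write eta = 1/(2a+2), b = a/(2a+2), g(t) = t^-(2a+2), so that G = g(B), and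
    let p = udag - ubar = phi(G) w. The proof compares the regularized solution
    u with the spectral cutoff u_alpha = ubar + 1_{G > alpha} p.

    Three bounds on the cutoff follow from the source condition. Since phi is
    monotone, the discarded part q = 1_{G <= alpha} p satisfies
    |q| <= phi(alpha) |w| and, as B^-a = G^b, also
    |q|_{-a} <= alpha^b phi(alpha) |w| = delta |w|. Since B = G^-eta and
    phi(t)/t^eta decreases near 0, the retained part r satisfies
    |r|_1 = O(phi(alpha)/alpha^eta). As udag is interior, u_alpha = udag - q is
    feasible for small delta. Comparing Tikhonov functionals at u and u_alpha,
    both |u - udag|_{-a} = O(delta) and sqrt alpha |u - ubar|_1 = O(delta)
    follow, because b + eta = 1/2. Finally v = u - u_alpha is controlled by

      |v|^2 <= alpha^(-2b) |v|_{-a}^2 + alpha^(2 eta) |v|_1^2,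

    which holds because x^(2b) + x^(-2 eta) >= 1 for x = g(t)/alpha > 0; with
    delta = phi(alpha) alpha^b the right side is O(phi(alpha)^2). The last two
    steps are tikhonov_error, the bounds on the cutoff are cutoff_low_norm,
    cutoff_low_weak and cutoff_high_strong.

    The norms are integrals against the spectral measure E of B, while the
    source condition speaks of the spectral measure EG of G. The two are
    related by the uniqueness of the spectral measure of a bounded operator,
    proved here in the form needed: if T is both the integral of f1 for E1 and
    of f2 for E2, then E1 {|f1| <= l} = E2 {|f2| <= l} (sproj_sublevel_eq),
    because the range of this projection consists of the u for which |T^n u|
    grows at most like l^n. Hence the integrals of a function of |f1| and of
    |f2| agree (integral_absf_eq). All this rests on an L^2 theory of spectral
    integrals: existence, the isometry |int f dE u|^2 = int f^2 d<E u, u>, and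
    commutation with the projections. *)

Set Implicit Arguments.
Unset Strict Implicit.
Unset Printing Implicit Defensive.

Import Order.TTheory GRing.Theory Num.Theory.
Import numFieldNormedType.Exports.
Import HBSimple.

Local Open Scope classical_set_scope.
Local Open Scope ring_scope.

(** * Spectral projections *)

Section hilbert_identities.
Context {R : realType} {X : hilbertType R}.
Implicit Types u v w : X.

Lemma innerZl (a : R) u w : inner (a *: u) w = a * inner u w.
Proof. by rewrite -[a *: u]addr0 inner_linearl inner0l addr0. Qed.

Lemma innerZr (a : R) u w : inner w (a *: u) = a * inner w u.
Proof. by rewrite innerC innerZl innerC. Qed.

Lemma inner_suml I (r : seq I) (f : I -> X) w :
  inner (\sum_(i <- r) f i) w = \sum_(i <- r) inner (f i) w.
Proof.
by apply: (big_morph (fun x => inner x w)) => [x y|]; rewrite ?innerDl ?inner0l.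
Qed.

Lemma inner_sumr I (r : seq I) (f : I -> X) w :
  inner w (\sum_(i <- r) f i) = \sum_(i <- r) inner w (f i).
Proof. by rewrite innerC inner_suml; apply: eq_bigr => i _; rewrite innerC. Qed.

Lemma normB_sqr_inner u v : `|u - v| ^+ 2 = `|u| ^+ 2 - 2 * inner u v + `|v| ^+ 2.
Proof.
rewrite -!inner_normE -scaleN1r innerDl !innerDr !innerZl !innerZr (innerC v u).
by ring.
Qed.

Lemma sqr_le_double (x y z : R) : 0 <= x -> x <= y + z ->
  x ^+ 2 <= 2 * y ^+ 2 + 2 * z ^+ 2.
Proof.
move=> x0 xyz; have : x ^+ 2 <= (y + z) ^+ 2 by apply: lerXn2r; rewrite ?nnegrE//; lra.
by have := sqr_ge0 (y - z); rewrite !expr2; nra.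
Qed.

Lemma normD_sqr_le u v : `|u + v| ^+ 2 <= 2 * `|u| ^+ 2 + 2 * `|v| ^+ 2.
Proof. by apply: sqr_le_double => //; exact: ler_normD. Qed.

End hilbert_identities.

Section spectral_projections.
Context {R : realType} {X : hilbertType R}.
Variable E : spectral_measure X.
Local Notation TR := (measurableTypeR R).
Implicit Types (u v w : X) (A B : set TR).

Lemma sprojZ A (c : R) u : measurable A -> E A (c *: u) = c *: E A u.
Proof.
move=> mA; have E0 : E A 0 = 0.
  by have := sproj_linear E mA (-1) 0 0; rewrite !scaleN1r !oppr0 !addr0 addNr.
by have := sproj_linear E mA c u 0; rewrite E0 !addr0.
Qed.

Lemma sprojD A u v : measurable A -> E A (u + v) = E A u + E A v.
Proof. by move=> mA; have := sproj_linear E mA 1 u v; rewrite !scale1r. Qed.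

Lemma sprojr0 A : measurable A -> E A 0 = 0.
Proof. by move=> mA; have := sprojZ 0 0 mA; rewrite !scale0r. Qed.

Lemma sprojB A u v : measurable A -> E A (u - v) = E A u - E A v.
Proof. by move=> mA; rewrite sprojD// -scaleN1r sprojZ// scaleN1r. Qed.

Lemma sproj_sum A I (r : seq I) (f : I -> X) : measurable A ->
  E A (\sum_(i <- r) f i) = \sum_(i <- r) E A (f i).
Proof.
move=> mA; apply: (big_morph (E A)) => [x y|]; [exact: sprojD|exact: sprojr0].
Qed.

Lemma inner_sproj A B u : measurable A -> measurable B ->
  inner (E A u) (E B u) = `|E (A `&` B) u| ^+ 2.
Proof.
move=> mA mB; have mAB := measurableI _ _ mA mB.
rewrite (sproj_sym E)// -sprojI// -inner_normE sproj_sym//.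
by rewrite -sprojI// setIid.
Qed.

Lemma sproj_contract A u : measurable A -> `|E A u| <= `|u|.
Proof.
move=> mA; rewrite -(@ler_pXn2r _ 2)// ?nnegrE//.
have := sqr_ge0 `|u - E A u|; rewrite normB_sqr_inner.
have := @inner_sproj setT A u measurableT mA.
by rewrite sprojT setTI => ->; lra.
Qed.

(** Finite additivity costs no limit: the square of the norm of the difference
    expands into values of the measure A |-> |E A u|^2, which is additive. *)
Lemma sprojU A B u : measurable A -> measurable B -> A `&` B = set0 ->
  E (A `|` B) u = E A u + E B u.
Proof.
move=> mA mB AB0; have mAB := measurableU _ _ mA mB.
have := @measureU _ _ _ (smeasure E u) _ _ mA mB AB0.
rewrite /= /smeasure -EFinD => -[muAB].
apply/eqP; rewrite -subr_eq0 -normr_eq0 -sqrf_eq0 normB_sqr_inner.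
have [ABA ABB] : (A `|` B) `&` A = A /\ (A `|` B) `&` B = B.
  by split; [rewrite setUK|rewrite setUC setUK].
rewrite innerDr !inner_sproj// ABA ABB muAB normD_sqr; first by apply/eqP; ring.
by rewrite inner_sproj// AB0 sproj0 normr0 expr0n.
Qed.

Lemma sproj_setC A u : measurable A -> u = E A u + E (~` A) u.
Proof.
move=> mA; rewrite -sprojU ?setUv ?sprojT ?setICr//.
exact: measurableC.
Qed.

Lemma sproj_compl0 A u : measurable A -> E (~` A) u = 0 -> E A u = u.
Proof. by move=> mA h; rewrite [RHS](sproj_setC u mA) h addr0. Qed.

(** A finitely valued s, with values in any type, splits E A along its fibers.
    Pairs of simple functions are handled through s t = (s1 t, s2 t). *)
Lemma sproj_fibers (T : eqType) A (s : TR -> T) (r : seq T) u : measurable A ->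
  (forall y, measurable (s @^-1` [set y])) -> uniq r ->
  (forall t, s t \in r) ->
  E A u = \sum_(y <- r) E (A `&` s @^-1` [set y]) u.
Proof.
move=> mA ms ur sr.
have sub (q : seq T) : uniq q -> measurable (A `&` [set t | s t \in q]) /\
  E (A `&` [set t | s t \in q]) u = \sum_(y <- q) E (A `&` s @^-1` [set y]) u.
  elim: q => [_|y q IHq /= /andP[yq uq]].
    have -> : A `&` [set t | s t \in [::]] = set0 by apply/seteqP; split => t [].
    by rewrite big_nil sproj0.
  have [mq Eq] := IHq uq; have my := measurableI _ _ mA (ms y).
  have -> : A `&` [set t | s t \in y :: q] =
      (A `&` s @^-1` [set y]) `|` (A `&` [set t | s t \in q]).
    rewrite -setIUr; congr setI; apply/seteqP; split => t /=.
      by rewrite inE => /orP[/eqP|]; [left|right].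
    by rewrite inE => -[->|->]; rewrite ?eqxx ?orbT.
  split; first exact: measurableU.
  rewrite sprojU// ?big_cons ?Eq//; apply/seteqP; split => t //= -[[_ sy] [_]].
  by rewrite sy (negbTE yq).
rewrite -(sub r ur).2; congr (E _ u); apply/seteqP; split => t.
  by move=> At; split => //=; exact: sr.
by case.
Qed.

Lemma smeasure_le_norm u A : measurable A -> (smeasure E u A <= (`|u| ^+ 2)%:E)%E.
Proof.
move=> mA; rewrite /smeasure lee_fin lerXn2r ?nnegrE//; exact: sproj_contract.
Qed.

Lemma smeasureT u : smeasure E u setT = (`|u| ^+ 2)%:E.
Proof. by rewrite /smeasure sprojT. Qed.

Lemma smeasureD_le u v A : measurable A ->
  (smeasure E (u + v)%R A <= 2%:E * smeasure E u A + 2%:E * smeasure E v A)%E.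
Proof.
by move=> mA; rewrite /smeasure sprojD// -!EFinM -EFinD lee_fin; exact: normD_sqr_le.
Qed.

Lemma smeasure_sproj u A B : measurable A -> measurable B ->
  smeasure E (E A u) B = smeasure E u (A `&` B).
Proof. by move=> mA mB; rewrite /smeasure -sprojI// setIC. Qed.

End spectral_projections.

(** * Integrals of simple functions *)

Section simple_integrals.
Context {R : realType} {X : hilbertType R}.
Variable E : spectral_measure X.
Local Notation TR := (measurableTypeR R).
Implicit Types (u v w : X) (A B : set TR).

Section fibers.
Variables (T : eqType) (q : TR -> T) (P : seq T).
Hypotheses (mq : forall p, measurable (q @^-1` [set p])) (uP : uniq P).
Hypothesis qP : forall t, q t \in P.

Let fiberI p p' : p != p' -> q @^-1` [set p] `&` q @^-1` [set p'] = set0.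
Proof.
move=> /eqP pp'; apply/seteqP; split => t //= -[qp qp'].
by apply: pp'; rewrite -qp -qp'.
Qed.

Lemma integral_fibers (mu : {measure set TR -> \bar R}) (k : T -> R) :
  (forall p, 0 <= k p) ->
  (\int[mu]_t (k (q t))%:E = \sum_(p <- P) (k p)%:E * mu (q @^-1` [set p]))%E.
Proof.
move=> k0; have kE t : (k (q t))%:E =
    (\sum_(p <- P) (k p * \1_(q @^-1` [set p]) t)%:E)%E.
  rewrite sumEFin (bigD1_seq (q t))//= big1 => [|p pq].
    by rewrite indicE mem_set// mulr1 addr0.
  by rewrite indicE memNset ?mulr0//= => /esym/eqP; rewrite (negbTE pq).
under eq_integral do rewrite kE.
rewrite ge0_integral_sum//; last 2 first.
- move=> p; apply/measurable_EFinP; apply: measurable_funM => //.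
- by move=> p t _; rewrite lee_fin mulr_ge0.
apply: eq_bigr => p _.
under eq_integral do rewrite EFinM.
rewrite ge0_integralZl//; last 2 first.
- by apply/measurable_EFinP.
- by rewrite lee_fin.
by rewrite integral_indic// setIT.
Qed.

(** Pythagoras: distinct fibers have orthogonal spectral projections. *)
Lemma norm_fiber_sum (c : T -> R) u :
  ((`|\sum_(p <- P) c p *: E (q @^-1` [set p]) u| ^+ 2)%:E =
   \int[smeasure E u]_t (c (q t) ^+ 2)%:E)%E.
Proof.
rewrite (@integral_fibers _ (fun p => c p ^+ 2)); last by move=> p; exact: sqr_ge0.
rewrite (eq_bigr (fun p => (c p ^+ 2 * `|E (q @^-1` [set p]) u| ^+ 2)%:E)); last first.
  by move=> p _; rewrite EFinM.
rewrite sumEFin; congr EFin.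
rewrite -inner_normE inner_suml; apply: eq_big_seq => p pP.
rewrite inner_sumr (bigD1_seq p)//= big1 => [|p' p'p].
  by rewrite innerZl innerZr inner_normE addr0; ring.
rewrite innerZl innerZr inner_sproj// setIC fiberI// sproj0 normr0 expr0n.
by rewrite !mulr0.
Qed.

Lemma spectral_sint_fibers (s : {sfun TR >-> R}) (h : T -> R) u :
  (forall t, s t = h (q t)) ->
  spectral_sint E s u = \sum_(p <- P) h p *: E (q @^-1` [set p]) u.
Proof.
move=> sh; rewrite /spectral_sint fsbig_finite//=.
have ms y : measurable (s @^-1` [set y]).
  by rewrite -[X in measurable X]setTI; exact: measurable_funP.
under eq_bigr => y _.
  rewrite (sproj_fibers E (s := q) (r := P) u (ms y))// scaler_sumr; over.
rewrite exchange_big/=; apply: eq_bigr => p _.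
rewrite (sproj_fibers E (s := s) (r := enum_fset (fset_set (range s))) u (mq p))//.
  rewrite scaler_sumr; apply: eq_bigr => y _; rewrite setIC.
  have [->//|yp] := eqVneq y (h p).
  suff -> : q @^-1` [set p] `&` s @^-1` [set y] = set0 by rewrite sproj0 !scaler0.
  apply/seteqP; split => t //= -[qp sy].
  by move/eqP : yp; apply; rewrite -sy sh qp.
- exact: fset_uniq.
- by move=> t; rewrite in_fset_set// inE; exists t.
Qed.

End fibers.

(** The isometry at the level of differences: both integrals are expanded over
    the common refinement by the fibers of t |-> (s t, s' t). This avoids the
    linearity of the integral in s. *)
Lemma spectral_sint_dist (s s' : {sfun TR >-> R}) u :
  ((`|spectral_sint E s u - spectral_sint E s' u| ^+ 2)%:E =
   \int[smeasure E u]_t ((s t - s' t) ^+ 2)%:E)%E.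
Proof.
pose q (t : TR) := (s t, s' t).
pose P := [seq (y, z) | y <- fset_set (range s), z <- fset_set (range s')].
have mq p : measurable (q @^-1` [set p]).
  rewrite (_ : _ @^-1` _ = s @^-1` [set p.1] `&` s' @^-1` [set p.2]).
    by apply: measurableI; rewrite -[X in measurable X]setTI;
      exact: measurable_funP.
  by apply/seteqP; split => t /=; case: p => y z; [case|move=> [/= <- <-]].
have uP : uniq P by apply: allpairs_uniq => // -[? ?] [? ?].
have qP t : q t \in P.
  by apply: allpairs_f; rewrite in_fset_set// inE; exists t.
rewrite (spectral_sint_fibers mq uP qP (h := fst))//.
rewrite (spectral_sint_fibers mq uP qP (h := snd))// -sumrB.
under eq_bigr do rewrite -scalerBl.
exact: (norm_fiber_sum mq uP qP (fun p => p.1 - p.2)).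
Qed.

Lemma sproj_spectral_sint A (s : {sfun TR >-> R}) u : measurable A ->
  E A (spectral_sint E s u) = spectral_sint E s (E A u).
Proof.
move=> mA; rewrite /spectral_sint !fsbig_finite//= sproj_sum//.
apply: eq_bigr => y _; rewrite sprojZ//.
have ms : measurable (s @^-1` [set y]).
  by rewrite -[X in measurable X]setTI; exact: measurable_funP.
by rewrite -!sprojI// setIC.
Qed.

Lemma spectral_sint_norm (s : {sfun TR >-> R}) u :
  ((`|spectral_sint E s u| ^+ 2)%:E = \int[smeasure E u]_t ((s t) ^+ 2)%:E)%E.
Proof.
have ms p : measurable (s @^-1` [set p]).
  by rewrite -[X in measurable X]setTI; exact: measurable_funP.
have sP t : s t \in fset_set (range s) by rewrite in_fset_set// inE; exists t.
rewrite (spectral_sint_fibers ms (fset_uniq _) sP (h := id))//.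
exact: (norm_fiber_sum ms (fset_uniq _) sP id).
Qed.

End simple_integrals.

(** * Density of simple functions in L^2 *)

Section square_integrals.
Context d (T : measurableType d) (R : realType).
Implicit Types (mu : {measure set T -> \bar R}) (f g h : T -> R).

Lemma measurable_sqrE f : measurable_fun setT f ->
  measurable_fun setT (fun t => ((f t) ^+ 2)%:E).
Proof. by move=> mf; apply/measurable_EFinP; exact: measurable_funX. Qed.

Lemma integral_sqr_ge0 mu f : (0 <= \int[mu]_t ((f t) ^+ 2)%:E)%E.
Proof. by apply: integral_ge0 => t _; rewrite lee_fin sqr_ge0. Qed.

(** A substitute for the triangle inequality in L^2: a pointwise inequality
    between squares, such as (x + y)^2 <= (1 + e) x^2 + (1 + 1/e) y^2, passes to
    L^2 norms. *)
Lemma le_integral_sqr2 mu f g h (c e : R) : 0 <= c -> 0 <= e ->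
  measurable_fun setT f -> measurable_fun setT g -> measurable_fun setT h ->
  (forall t, f t ^+ 2 <= c * g t ^+ 2 + e * h t ^+ 2) ->
  (\int[mu]_t ((f t) ^+ 2)%:E <=
    c%:E * \int[mu]_t ((g t) ^+ 2)%:E + e%:E * \int[mu]_t ((h t) ^+ 2)%:E)%E.
Proof.
move=> c0 e0 mf mg mh fgh.
have pos (k : T -> R) t : setT t -> (0 <= ((k t) ^+ 2)%:E)%E.
  by move=> _; rewrite lee_fin sqr_ge0.
have mc (k : T -> R) (b : R) : measurable_fun setT k ->
    measurable_fun setT (fun t => b%:E * ((k t) ^+ 2)%:E)%E.
  move=> mk; under eq_fun do rewrite -EFinM.
  by apply/measurable_EFinP; apply: measurable_funM => //; exact: measurable_funX.
rewrite -!ge0_integralZl ?lee_fin//; try exact: measurable_sqrE; try exact: pos.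
rewrite -ge0_integralD//; try exact: mc; last 2 first.
- by move=> t _; rewrite -EFinM lee_fin mulr_ge0// sqr_ge0.
- by move=> t _; rewrite -EFinM lee_fin mulr_ge0// sqr_ge0.
apply: ge0_le_integral => //; [exact: pos|exact: measurable_sqrE| |].
  by apply: emeasurable_funD; exact: mc.
by move=> t _; rewrite -!EFinM -EFinD lee_fin.
Qed.

Import HBNNSimple.

(** The positive and negative parts are approximated from below, so the error
    is at most |f| pointwise and dominated convergence applies. *)
Lemma sfun_dense_sqr mu f : measurable_fun setT f ->
  (\int[mu]_t ((f t) ^+ 2)%:E < +oo)%E ->
  exists s : nat -> {sfun T >-> R},
    (\int[mu]_t ((s n t - f t) ^+ 2)%:E)%E @[n --> \oo] --> 0%E.
Proof.
move=> mf ffin.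
have mp : measurable_fun setT (EFin \o f^\+).
  by apply/measurable_EFinP; exact: measurable_funrpos.
have mn : measurable_fun setT (EFin \o f^\-).
  by apply/measurable_EFinP; exact: measurable_funrneg.
have p0 t : setT t -> (0 <= (EFin \o f^\+%R) t)%E by move=> _; rewrite lee_fin funrpos_ge0.
have n0 t : setT t -> (0 <= (EFin \o f^\-%R) t)%E by move=> _; rewrite lee_fin funrneg_ge0.
have fE t : f^\+ t - f^\- t = f t := congr1 (@^~ t) (funrposBneg f).
have aE t : f^\+ t + f^\- t = `|f t| := congr1 (@^~ t) (funrposDneg f).
pose p_ := nnsfun_approx measurableT mp.
pose n_ := nnsfun_approx measurableT mn.
exists (fun k => p_ k \+ cst (-1) \* n_ k).
have ple k t : 0 <= p_ k t <= f^\+ t.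
  by rewrite fun_ge0/= -lee_fin /p_ nnsfun_approxE; exact: (le_approx _ p0).
have nle k t : 0 <= n_ k t <= f^\- t.
  by rewrite fun_ge0/= -lee_fin /n_ nnsfun_approxE; exact: (le_approx _ n0).
rewrite -[X in _ --> X](integral0 mu setT).
apply: (@dominated_cvg _ _ _ mu setT measurableT _ (cst 0%E)
  (fun t => (f t ^+ 2)%:E)) => //.
- move=> k; apply: measurable_sqrE; exact: measurable_funB.
- move=> t _ /=; apply: cvg_EFin; first by near=> k.
  rewrite -[X in _ --> X](mulr0 0).
  suff h : ((p_ k t + -1 * n_ k t - f t) @[k --> \oo] --> 0).
    by rewrite /comp/=; under eq_fun do rewrite expr2; exact: cvgM.
  have -> : 0 = f^\+ t + -1 * f^\- t - f t.
    by rewrite -fE; ring.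
  have /fine_cvgP[_ cp] : (p_ k t)%:E @[k --> \oo] --> (f^\+ t)%:E.
    exact: (cvg_nnsfun_approx measurableT mp p0).
  have /fine_cvgP[_ cn] : (n_ k t)%:E @[k --> \oo] --> (f^\- t)%:E.
    exact: (cvg_nnsfun_approx measurableT mn n0).
  apply: cvgB; last exact: cvg_cst.
  by apply: cvgD; [exact: cp|apply: cvgM; [exact: cvg_cst|exact: cn]].
- apply/integrableP; split; first exact: measurable_sqrE.
  by under eq_integral do rewrite gee0_abs ?lee_fin ?sqr_ge0//.
- move=> k t _; rewrite gee0_abs ?lee_fin ?sqr_ge0//=.
  rewrite -(real_normK (num_real (f t))) -(real_normK (num_real (_ - _))).
  rewrite lerXn2r ?nnegrE// -aE ler_norml -(fE t).
  have /andP[? ?] := ple k t; have /andP[? ?] := nle k t.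
  by lra.
Unshelve. all: by end_near. Qed.

End square_integrals.

(** * Spectral integrals of square-integrable functions *)

Section spectral_integrals.
Context {R : realType} {X : hilbertType R}.
Variable E : spectral_measure X.
Local Notation TR := (measurableTypeR R).
Implicit Types (u v w : X) (A B : set TR) (f g : TR -> R).

(** |f(B) u|^2 for the operator B with spectral measure E, and +oo when u is not
    in the domain of f(B). *)
Definition energy f u : \bar R := (\int[smeasure E u]_t ((f t) ^+ 2)%:E)%E.

Lemma energy_ge0 f u : (0 <= energy f u)%E.
Proof. exact: integral_sqr_ge0. Qed.

Let near_le (e : nat -> \bar R) (b : R) : e n @[n --> \oo] --> 0%E -> 0 < b ->
  \forall n \near \oo, (e n <= b%:E)%E.
Proof.
move=> e0 b0; have /fine_cvgP[efin /cvgrPdist_le/(_ _ b0) eb] := e0.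
near=> n; have nfin : e n \is a fin_num by near: n.
rewrite -(fineK nfin) lee_fin.
have : `|0 - fine (e n)| <= b by near: n.
by rewrite sub0r normrN; apply: le_trans; exact: ler_norm.
Unshelve. all: by end_near. Qed.

Let sqr_le_double_fun f g h :
  (forall t, `|f t| <= `|g t| + `|h t|) ->
  forall t, f t ^+ 2 <= 2 * g t ^+ 2 + 2 * h t ^+ 2.
Proof.
move=> fgh t; rewrite -(real_normK (num_real (f t))).
rewrite -(real_normK (num_real (g t))) -(real_normK (num_real (h t))).
exact: sqr_le_double.
Qed.

(** Used both for a Cauchy sequence (s and s' from one approximation of f) and
    for uniqueness of the limit (two approximations). *)
Let sint_dist2 f (s s' : {sfun TR >-> R}) u : measurable_fun setT f ->
  ((`|spectral_sint E s u - spectral_sint E s' u| ^+ 2)%:E <=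
   2%:E * \int[smeasure E u]_t ((s t - f t) ^+ 2)%:E +
   2%:E * \int[smeasure E u]_t ((s' t - f t) ^+ 2)%:E)%E.
Proof.
move=> mf; rewrite spectral_sint_dist.
apply: le_integral_sqr2 => //; try exact: measurable_funB.
apply: sqr_le_double_fun => t; rewrite -[X in _ <= _ + X]normrN.
by apply: le_trans (ler_normD _ _); rewrite le_eqVlt; apply/orP; left; apply/eqP;
  congr (`|_|); ring.
Qed.

(** An L^2 approximation of f by simple functions gives a Cauchy sequence of
    integrals, by the isometry and completeness of X. *)
Lemma is_spectral_int_ex f u : measurable_fun setT f -> (energy f u < +oo)%E ->
  exists v, is_spectral_int E f u v.
Proof.
move=> mf ffin; have [s sf] := sfun_dense_sqr mf ffin.
suff /cvg_ex[v sv] : cvgn (fun n => spectral_sint E (s n) u) by exists v, s.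
apply/cauchy_cvgP; apply/cauchy_ballP => e e0.
have e20 : 0 < e ^+ 2 / 16 by rewrite divr_gt0// exprn_gt0.
have [N _ NP] := near_le sf e20.
exists ([set spectral_sint E (s n) u | n in [set n | (N <= n)%N]],
        [set spectral_sint E (s n) u | n in [set n | (N <= n)%N]]).
  by split => /=; exists N => // n /= Nn; exists n.
move=> [x y] /= [[n /= Nn <-] [k /= Nk <-]].
rewrite -ball_normE/=.
have := sint_dist2 (s n) (s k) u mf.
have n2 : (0 <= 2%:E :> \bar R)%E by rewrite lee_fin.
move=> /le_trans/(_ (leeD (lee_wpmul2l n2 (NP _ Nn)) (lee_wpmul2l n2 (NP _ Nk)))).
rewrite -!EFinM -EFinD lee_fin => h.
rewrite -(@ltr_pXn2r _ 2)// ?nnegrE ?(ltW e0)//.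
by apply: le_lt_trans h _; nra.
Qed.

Lemma is_spectral_int_uniq f u v v' : measurable_fun setT f ->
  is_spectral_int E f u v -> is_spectral_int E f u v' -> v = v'.
Proof.
move=> mf [s [sf sv]] [s' [s'f s'v']].
apply/eqP; rewrite -subr_eq0 -normr_le0; apply/ler_addgt0Pr => e e0; rewrite add0r.
have e20 : 0 < e ^+ 2 / 16 by rewrite divr_gt0// exprn_gt0.
have dv : (spectral_sint E (s n) u - spectral_sint E (s' n) u) @[n --> \oo] --> v - v'.
  exact: cvgB.
apply: (ler_cvg_to (cvg_norm dv) (cvg_cst e)).
near=> n.
have n2 : (0 <= 2%:E :> \bar R)%E by rewrite lee_fin.
have := sint_dist2 (s n) (s' n) u mf.
have s1 : ((\int[smeasure E u]_t ((s n t - f t) ^+ 2)%:E) <= (e ^+ 2 / 16)%:E)%E.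
  by near: n; exact: near_le.
have s2 : ((\int[smeasure E u]_t ((s' n t - f t) ^+ 2)%:E) <= (e ^+ 2 / 16)%:E)%E.
  by near: n; exact: near_le.
move=> /le_trans/(_ (leeD (lee_wpmul2l n2 s1) (lee_wpmul2l n2 s2))).
rewrite -!EFinM -EFinD lee_fin => h.
rewrite -(@ler_pXn2r _ 2)// ?nnegrE ?(ltW e0)//.
by apply: le_trans h _; nra.
Unshelve. all: by end_near. Qed.

Let le_of_slack (x y K : R) : 0 <= K ->
  (forall e, 0 < e -> e <= 1 -> x <= y + e * K) -> x <= y.
Proof.
move=> K0 h; apply/ler_addgt0Pr => e e0.
have [e1|e1] := leP (e / (K + 1)) 1.
  apply: le_trans (h _ _ e1) _; first by rewrite divr_gt0//; lra.
  rewrite lerD2l -mulrA ler_piMr ?(ltW e0)//.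
  by rewrite mulrC ler_pdivrMr; lra.
apply: le_trans (h 1 _ _) _ => //; rewrite mul1r lerD2l.
by move: e1; rewrite ltr_pdivlMr; lra.
Qed.

Let weighted_sqr (x y e : R) : 0 < e ->
  (x + y) ^+ 2 <= (1 + e) * x ^+ 2 + (1 + e^-1) * y ^+ 2.
Proof.
move=> e0; rewrite -subr_ge0.
have -> : (1 + e) * x ^+ 2 + (1 + e^-1) * y ^+ 2 - (x + y) ^+ 2 =
    e^-1 * (e * x - y) ^+ 2 by field; rewrite gt_eqF.
by rewrite mulr_ge0 ?sqr_ge0// invr_ge0 ltW.
Qed.

(** The isometry passes to the limit: for an approximation s of f, the energy
    of s is an exact square norm, and the energies of s and f are comparable up
    to factors 1 + e and errors that vanish with |s - f|. *)
Lemma is_spectral_int_norm f u v : measurable_fun setT f ->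
  is_spectral_int E f u v -> energy f u = (`|v| ^+ 2)%:E.
Proof.
move=> mf [s [sf sv]].
have sv2 : `|spectral_sint E (s n) u| ^+ 2 @[n --> \oo] --> `|v| ^+ 2.
  by rewrite expr2; under eq_fun do rewrite expr2; apply: cvgM; exact: cvg_norm.
have close e : 0 < e -> exists s' : {sfun TR >-> R},
    (\int[smeasure E u]_t ((s' t - f t) ^+ 2)%:E <= e%:E)%E /\
    `| `|v| ^+ 2 - `|spectral_sint E s' u| ^+ 2 | <= e.
  move=> e0; near \oo => n; exists (s n); split; near: n; first exact: near_le.
  by move/cvgrPdist_le : sv2; exact.
have up s' e : 0 < e -> (energy f u <=
    (1 + e)%:E * (`|spectral_sint E s' u| ^+ 2)%:E +
    (1 + e^-1)%:E * \int[smeasure E u]_t ((s' t - f t) ^+ 2)%:E)%E.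
  move=> e0; have ? : 0 <= e^-1 by rewrite invr_ge0 ltW.
  rewrite spectral_sint_norm; apply: le_integral_sqr2 => //; try lra.
    exact: measurable_funB.
  move=> t; have := weighted_sqr (s' t) (f t - s' t) e0.
  by rewrite addrC subrK -(sqrrN (f t - _)) opprB.
have lo s' e : 0 < e -> ((`|spectral_sint E s' u| ^+ 2)%:E <=
    (1 + e)%:E * energy f u +
    (1 + e^-1)%:E * \int[smeasure E u]_t ((s' t - f t) ^+ 2)%:E)%E.
  move=> e0; have ? : 0 <= e^-1 by rewrite invr_ge0 ltW.
  rewrite spectral_sint_norm; apply: le_integral_sqr2 => //; try lra.
    exact: measurable_funB.
  by move=> t; have := weighted_sqr (f t) (s' t - f t) e0; rewrite addrC subrK.
have pe e : 0 < e -> (0 <= (1 + e)%:E :> \bar R)%E /\ (0 <= (1 + e^-1)%:E :> \bar R)%E.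
  move=> e0; have ? : 0 <= e^-1 by rewrite invr_ge0 ltW.
  by rewrite !lee_fin; split; lra.
have ffin : energy f u \is a fin_num.
  rewrite ge0_fin_numE; last exact: energy_ge0.
  have [s' [s'f _]] := close 1 ltr01.
  apply: le_lt_trans (up s' 1 ltr01) _.
  apply: (@le_lt_trans _ _ ((1 + 1)%:E * (`|spectral_sint E s' u| ^+ 2)%:E +
    (1 + 1^-1)%:E * 1%:E)%E).
    by apply: leeD => //; apply: lee_wpmul2l => //; rewrite lee_fin.
  by rewrite -!EFinM -EFinD ltry.
have I0 := energy_ge0 f u.
move: up lo I0; rewrite -(fineK ffin) lee_fin; set I := fine _ => up lo I0.
congr EFin; apply/eqP; rewrite eq_le.
(* The approximation is chosen within e ^+ 2 so that (1 + 1/e) * e ^+ 2, the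
   price of the weighted inequality, still vanishes with e. *)
have slack e : 0 < e -> e <= 1 -> exists V, [/\ `| `|v| ^+ 2 - V | <= e ^+ 2,
    I <= (1 + e) * V + (e ^+ 2 + e) & V <= (1 + e) * I + (e ^+ 2 + e)].
  move=> e0 e1; have [|s' [s'f s'v]] := close (e ^+ 2); first exact: exprn_gt0.
  exists (`|spectral_sint E s' u| ^+ 2); split => //.
    rewrite -lee_fin; apply: le_trans (up s' e e0) _.
    apply: le_trans (leeD (lexx _) (lee_wpmul2l (pe e e0).2 s'f)) _.
    rewrite -!EFinM -EFinD lee_fin lerD2l le_eqVlt; apply/orP; left; apply/eqP.
    by field; rewrite gt_eqF.
  rewrite -lee_fin; apply: le_trans (lo s' e e0) _.
  apply: le_trans (leeD (lexx _) (lee_wpmul2l (pe e e0).2 s'f)) _.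
  rewrite -!EFinM -EFinD lee_fin lerD2l le_eqVlt; apply/orP; left; apply/eqP.
  by field; rewrite gt_eqF.
apply/andP; split.
  apply: (@le_of_slack _ _ (`|v| ^+ 2 + 4)); first by rewrite addr_ge0 ?sqr_ge0.
  move=> e e0 e1; have [V [/ler_normlP[? ?] IV _]] := slack e e0 e1.
  by move: (sqr_ge0 `|v|) => ?; nra.
apply: (@le_of_slack _ _ (I + 4)); first by rewrite addr_ge0.
move=> e e0 e1; have [V [/ler_normlP[? ?] _ VI]] := slack e e0 e1.
by nra.
Unshelve. all: by end_near. Qed.

Lemma energy_sproj f u A : measurable A -> measurable_fun setT f ->
  (energy f (E A u) <= energy f u)%E.
Proof.
move=> mA mf; apply: ge0_le_measure_integral => //.
- move=> S mS; rewrite [leLHS](_ : _ = smeasure E u (A `&` S)); last exact: smeasure_sproj.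
  by apply: le_measure; rewrite ?inE//; exact: measurableI.
- by move=> t; rewrite lee_fin sqr_ge0.
- exact: measurable_sqrE.
Qed.

Lemma is_spectral_int_sproj f u v A : measurable A -> measurable_fun setT f ->
  is_spectral_int E f u v -> is_spectral_int E f (E A u) (E A v).
Proof.
move=> mA mf [s [sf sv]]; exists s; split.
  apply: (squeeze_cvge _ (cvg_cst 0%E) sf); apply: nearW => n.
  rewrite integral_sqr_ge0/=; apply: energy_sproj => //; exact: measurable_funB.
apply/cvgrPdist_le => e e0; move/cvgrPdist_le : sv => /(_ e e0) sv.
near=> n; rewrite -sproj_spectral_sint// -sprojB//.
by apply: le_trans (sproj_contract _ _ mA) _; near: n.
Unshelve. all: by end_near. Qed.

Lemma spectral_intP f u : measurable_fun setT f -> (energy f u < +oo)%E ->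
  is_spectral_int E f u (spectral_int E f u).
Proof.
move=> mf /(is_spectral_int_ex mf)[v fv]; rewrite /spectral_int.
by apply: (@xgetPex _ 0 [set v | is_spectral_int E f u v]); exists v.
Qed.

Lemma spectral_int_eq f u v : measurable_fun setT f ->
  is_spectral_int E f u v -> spectral_int E f u = v.
Proof.
move=> mf fv; apply: (is_spectral_int_uniq mf _ fv); apply: spectral_intP => //.
by rewrite (is_spectral_int_norm mf fv) ltry.
Qed.

Lemma spectral_int_norm f u : measurable_fun setT f -> (energy f u < +oo)%E ->
  (`|spectral_int E f u| ^+ 2)%:E = energy f u.
Proof. by move=> mf ffin; rewrite (is_spectral_int_norm mf (spectral_intP mf ffin)). Qed.

Lemma spectral_int_sproj f u A : measurable A -> measurable_fun setT f ->
  (energy f u < +oo)%E ->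
  E A (spectral_int E f u) = spectral_int E f (E A u).
Proof.
move=> mA mf ffin; apply/esym/spectral_int_eq => //.
by apply: is_spectral_int_sproj => //; exact: spectral_intP.
Qed.

End spectral_integrals.

(** * Measures with a density and energies of projected vectors *)

Section density_bound.
Context {R : realType}.
Local Notation TR := (measurableTypeR R).
Variables (mu nu : {measure set TR -> \bar R}) (k : TR -> R).
Hypotheses (mk : measurable_fun setT k) (k0 : forall t, 0 <= k t).
Hypothesis nuk : forall B, measurable B -> (nu B <= \int[mu]_(t in B) (k t)%:E)%E.

Import HBNNSimple.

Let density_nnsfun (s : {nnsfun TR >-> R}) :
  (\int[nu]_t (s t)%:E <= \int[mu]_t (s t * k t)%:E)%E.
Proof.
pose r := enum_fset (fset_set (range s)).
have ms p : measurable (s @^-1` [set p]).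
  by rewrite -[X in measurable X]setTI; exact: measurable_funP.
have sP t : s t \in r by rewrite in_fset_set// inE; exists t.
have sN t : s t = `|s t| by rewrite ger0_norm.
under eq_integral do rewrite sN.
rewrite (integral_fibers ms (fset_uniq _) sP nu (k := Num.norm))//.
under [in leRHS]eq_integral => t _.
  have -> : (s t * k t)%:E =
      (\sum_(p <- r) (`|p| * (k t * \1_(s @^-1` [set p]) t))%:E)%E.
    rewrite sumEFin (bigD1_seq (s t))//=; last exact: fset_uniq.
    rewrite big1 => [|p /eqP ps].
      by rewrite indicE mem_set// mulr1 addr0 -sN.
    by rewrite indicE memNset ?mulr0//= => /esym.
  over.
rewrite ge0_integral_sum//; last 2 first.
- move=> p; apply/measurable_EFinP; apply: measurable_funM => //.
  by apply: measurable_funM => //.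
- by move=> p t _; rewrite lee_fin !mulr_ge0.
apply: lee_sum => p _.
under eq_integral do rewrite EFinM.
rewrite ge0_integralZl//; last 2 first.
- by apply/measurable_EFinP; apply: measurable_funM.
- by move=> t _; rewrite lee_fin mulr_ge0.
apply: lee_wpmul2l; first by rewrite lee_fin.
rewrite (le_trans (nuk (ms p)))// [leLHS]integral_mkcond le_eqVlt; apply/orP; left.
apply/eqP; apply: eq_integral => t _; rewrite /patch indicE.
by case: ifP => _; rewrite ?mulr1 ?mulr0.
Qed.

(** Only an inequality between a measure and a density is at hand in the
    applications; it passes to integrals of nonnegative functions, first for
    simple ones. *)
Lemma le_integral_density (h : TR -> R) :
  measurable_fun setT h -> (forall t, 0 <= h t) ->
  (\int[nu]_t (h t)%:E <= \int[mu]_t (h t * k t)%:E)%E.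
Proof.
move=> mh h0; rewrite ge0_integralTE; last by move=> t; rewrite lee_fin.
apply: ge_ereal_sup => _ [s /= sh <-].
have := density_nnsfun s; rewrite integral_nnsfun// patch_setT => /le_trans; apply.
apply: ge0_le_integral => //.
- by move=> t _; rewrite lee_fin mulr_ge0.
- by apply/measurable_EFinP; exact: measurable_funM.
- by apply/measurable_EFinP; exact: measurable_funM.
- by move=> t _; rewrite lee_fin ler_wpM2r// -lee_fin.
Qed.

End density_bound.

Section energy_bounds.
Context {R : realType} {X : hilbertType R}.
Variable E : spectral_measure X.
Local Notation TR := (measurableTypeR R).
Implicit Types (u v w : X) (A B : set TR) (f g : TR -> R).

Lemma energyD_le f u v : measurable_fun setT f ->
  (energy E f (u + v)%R <= 2%:E * energy E f u + 2%:E * energy E f v)%E.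
Proof.
move=> mf; have f0 t : (0 <= (f t ^+ 2)%:E)%E by rewrite lee_fin sqr_ge0.
have mf2 := measurable_sqrE mf.
pose two := NngNum (ler0n R 2).
pose m2 := measure_add (mscale two (smeasure E u)) (mscale two (smeasure E v)).
apply: (@le_trans _ _ (\int[m2]_t (f t ^+ 2)%:E)%E).
  apply: ge0_le_measure_integral => // S mS.
  by rewrite [leRHS]measure_addE; exact: smeasureD_le.
by rewrite ge0_integral_measure_add// !ge0_integral_mscale.
Qed.

(** The measure of E A u is that of u restricted to A. *)
Lemma energy_sproj_indic f u A : measurable A -> measurable_fun setT f ->
  (energy E f (E A u) <= \int[smeasure E u]_t (f t ^+ 2 * \1_A t)%:E)%E.
Proof.
move=> mA mf; apply: (@le_integral_density _ (smeasure E u) (smeasure E (E A u))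
  (\1_A) _ _ _ (fun t => f t ^+ 2)) => //.
- move=> B mB; rewrite integral_indic// [leLHS](smeasure_sproj E u mA mB).
  by [].
- exact: measurable_funX.
- by move=> t; exact: sqr_ge0.
Qed.

Lemma energy_sproj_le f u A (K : R) : measurable A -> measurable_fun setT f ->
  0 <= K -> (forall t, A t -> `|f t| <= K) ->
  (energy E f (E A u) <= (K ^+ 2 * `|E A u| ^+ 2)%:E)%E.
Proof.
move=> mA mf K0 fK; have EAA : E A u = E A (E A u) by rewrite -sprojI// setIid.
rewrite {1}EAA (le_trans (energy_sproj_indic _ mA mf))//.
rewrite EFinM -(smeasureT E) -(integral_cst (smeasure E (E A u)) measurableT).
apply: ge0_le_integral => //.
- by move=> t _; rewrite lee_fin mulr_ge0// sqr_ge0.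
- apply/measurable_EFinP; apply: measurable_funM => //; exact: measurable_funX.
move=> t _; rewrite lee_fin indicE.
case: (boolP (t \in A)) => [|_]; last by rewrite mulr0 sqr_ge0.
rewrite inE mulr1 => At; rewrite -(real_normK (num_real (f t))).
by rewrite lerXn2r ?nnegrE ?fK.
Qed.

Lemma energy_sproj_ge f u A (K : R) : measurable A -> measurable_fun setT f ->
  0 <= K -> (forall t, A t -> K <= `|f t|) ->
  ((K ^+ 2 * `|E A u| ^+ 2)%:E <= energy E f (E A u))%E.
Proof.
move=> mA mf K0 fK; have mf2 := measurable_sqrE mf.
apply: (@le_trans _ _ (\int[smeasure E (E A u)]_(t in A) (f t ^+ 2)%:E)%E); last first.
  by apply: ge0_subset_integral => // t _; rewrite lee_fin sqr_ge0.
rewrite EFinM (_ : (`|E A u| ^+ 2)%:E = smeasure E (E A u) A); last first.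
  by rewrite /smeasure -sprojI// setIid.
rewrite -(integral_cst (smeasure E (E A u)) mA).
apply: ge0_le_integral => //.
- by move=> t _; rewrite lee_fin sqr_ge0.
- exact: measurable_funTS.
move=> t At; rewrite lee_fin -(real_normK (num_real (f t))).
by rewrite lerXn2r ?nnegrE ?fK.
Qed.

End energy_bounds.

(** * Uniqueness of the spectral measure of an everywhere defined operator *)

(** T is the operator f(B) for the B with spectral measure E, and it is defined
    on the whole space. *)
Definition everywhere_spectral_int (R : realType) (X : hilbertType R)
    (E : spectral_measure X) (f : R -> R) (T : X -> X) :=
  forall u, (energy E f u < +oo)%E /\ T u = spectral_int E f u.

Section uniqueness.
Context {R : realType} {X : hilbertType R}.
Local Notation TR := (measurableTypeR R).

(** Taken with the absolute value because the growth of the powers of f(B) only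
    detects |f|. *)
Definition sublevel (f : TR -> R) (l : R) : set TR := [set t | `|f t| <= l].

Lemma measurable_sublevel f l : measurable_fun setT f -> measurable (sublevel f l).
Proof.
move=> mf; have mnf : measurable_fun setT (fun t => `|f t|).
  by apply: measurableT_comp.
rewrite -[sublevel f l]setTI -[X in _ `&` X]/((fun t => `|f t|) @^-1` [set x | x <= l]).
by rewrite -set_itvNyc; apply: mnf.
Qed.

Section comparison.
Variables (E1 E2 : spectral_measure X) (f1 f2 : TR -> R) (T : X -> X).
Hypotheses (mf1 : measurable_fun setT f1) (mf2 : measurable_fun setT f2).
Hypotheses (T1 : everywhere_spectral_int E1 f1 T) (T2 : everywhere_spectral_int E2 f2 T).

(** On the range of E1 {|f1| <= l} powers of T grow at most like l ^+ n; on the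
    range of E2 {|f2| > l'} they grow at least like l' ^+ n. Both projections
    commute with T, so the second kills the range of the first when l < l'. *)
Let sproj_sublevel_gap l l' u : 0 <= l -> l < l' ->
  E2 (~` sublevel f2 l') (E1 (sublevel f1 l) u) = 0.
Proof.
move=> l0 ll'; have mA := measurable_sublevel l mf1.
set A := sublevel f1 l in mA *.
have mB := measurableC (measurable_sublevel l' mf2).
set B := ~` sublevel f2 l' in mB *.
have l'0 : 0 <= l' by exact: ltW (le_lt_trans l0 ll').
set v := E1 A u.
have up n : E1 A (iter n T v) = iter n T v /\ `|iter n T v| <= l ^+ n * `|v|.
  elim: n => [|n [IHA IH]] /=; first by rewrite -sprojI// setIid expr0 mul1r.
  set z := iter n T v in IHA IH *.
  have [zfin ->] := T1 z; rewrite spectral_int_sproj// IHA; split => //.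
  apply: le_trans (_ : l * `|z| <= _); last by rewrite exprS -mulrA ler_wpM2l.
  rewrite -(@ler_pXn2r _ 2)// ?nnegrE ?mulr_ge0// -lee_fin spectral_int_norm//.
  by rewrite -IHA exprMn; exact: energy_sproj_le.
have lo n : l' ^+ n * `|E2 B v| <= `|E2 B (iter n T v)|.
  elim: n => [|n IH] /=; first by rewrite expr0 mul1r.
  set z := iter n T v in IH *.
  have [zfin ->] := T2 z; rewrite spectral_int_sproj//.
  have Bzfin : (energy E2 f2 (E2 B z) < +oo)%E.
    by apply: le_lt_trans zfin; exact: energy_sproj.
  apply: (@le_trans _ _ (l' * `|E2 B z|)); first by rewrite exprS -mulrA ler_wpM2l.
  rewrite -(@ler_pXn2r _ 2)// ?nnegrE ?mulr_ge0// -lee_fin spectral_int_norm//.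
  rewrite exprMn; apply: energy_sproj_ge => // t.
  by rewrite /B/= => /negP; rewrite -ltNge => /ltW.
have bound n : `|E2 B v| <= (l / l') ^+ n * `|v|.
  have l'n : 0 < l' ^+ n by rewrite exprn_gt0// (le_lt_trans l0).
  rewrite expr_div_n mulrAC ler_pdivlMr// mulrC.
  by apply: le_trans (lo n) (le_trans (sproj_contract _ _ mB) (up n).2).
apply/eqP; rewrite -normr_le0.
have c0 : (l / l') ^+ n * `|v| @[n --> \oo] --> (0 : R).
  rewrite -[X in _ --> X](mul0r `|v|); apply: cvgMl; apply: cvg_expr.
  rewrite ger0_norm ?divr_ge0// ltr_pdivrMr ?mul1r//.
  exact: le_lt_trans ll'.
apply: (ler_cvg_to (cvg_cst `|E2 B v|) c0).
by apply: nearW.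
Qed.

(** {|f2| > l} is the increasing union of the sets {|f2| > l + 1/(k+1)}, each of
    which is null by the growth argument. *)
Lemma sproj_sublevel_sub l u : 0 <= l ->
  E2 (sublevel f2 l) (E1 (sublevel f1 l) u) = E1 (sublevel f1 l) u.
Proof.
move=> l0; set v := E1 _ u.
apply: sproj_compl0; first exact: measurable_sublevel.
have mC k : measurable (~` sublevel f2 (l + k.+1%:R^-1)).
  by apply: measurableC; exact: measurable_sublevel.
have -> : ~` sublevel f2 l = \bigcup_k ~` sublevel f2 (l + k.+1%:R^-1).
  apply/seteqP; split => t /=; rewrite /sublevel/=.
    move=> /negP; rewrite -ltNge => lt; exists (Num.truncn ((`|f2 t| - l)^-1)) => //=.
    apply/negP; rewrite -ltNge -ltrBrDl.
    rewrite invf_plt ?posrE ?subr_gt0//.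
    by rewrite truncnS_gt.
  move=> [k _] /= /negP; rewrite -ltNge => lt; apply/negP; rewrite -ltNge.
  by apply: lt_trans lt; rewrite ltrDl.
suff : (smeasure E2 v).-negligible (\bigcup_k ~` sublevel f2 (l + k.+1%:R^-1)).
  move/negligibleP => /(_ (bigcup_measurable (fun k _ => mC k))).
  by move=> [] /eqP; rewrite sqrf_eq0 normr_eq0 => /eqP.
apply: negligible_bigcup => k; apply/negligibleP => //.
rewrite [LHS](_ : _ = (`|E2 (~` sublevel f2 (l + k.+1%:R^-1)) v| ^+ 2)%:E)//.
by rewrite sproj_sublevel_gap ?ltrDl// normr0 expr0n.
Qed.

End comparison.

Variables (E1 E2 : spectral_measure X) (f1 f2 : TR -> R) (T : X -> X).
Hypotheses (mf1 : measurable_fun setT f1) (mf2 : measurable_fun setT f2).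
Hypotheses (T1 : everywhere_spectral_int E1 f1 T) (T2 : everywhere_spectral_int E2 f2 T).

(** Two orthogonal projections each of which fixes the range of the other are
    equal. *)
Lemma sproj_sublevel_eq l u : E1 (sublevel f1 l) u = E2 (sublevel f2 l) u.
Proof.
have [l0|l0] := leP 0 l; last first.
  have e f : sublevel f l = set0.
    apply/seteqP; split => t //=; rewrite /sublevel/= => h.
    by have := le_lt_trans h l0; rewrite normr_lt0.
  by rewrite !e !sproj0.
have m1 := measurable_sublevel l mf1; have m2 := measurable_sublevel l mf2.
set A := sublevel f1 l in m1 *; set B := sublevel f2 l in m2 *.
have BA w : E2 B (E1 A w) = E1 A w := sproj_sublevel_sub mf1 mf2 T1 T2 w l0.
have AB w : E1 A (E2 B w) = E2 B w := sproj_sublevel_sub mf2 mf1 T2 T1 w l0.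
have AiB w : inner (E1 A u) w = inner (E2 B u) w.
  by rewrite -BA sproj_sym// sproj_sym// AB -sproj_sym.
apply/eqP; rewrite -subr_eq0 -normr_eq0 -sqrf_eq0 -inner_normE.
by rewrite -scaleN1r innerDl innerZl AiB mulN1r subrr.
Qed.

(** The half-lines form a pi-system generating the Borel sets, and on them the
    two image measures agree. *)
Lemma smeasure_absf_eq u (A : set TR) : measurable A ->
  smeasure E1 u ((fun t => `|f1 t|) @^-1` A) =
  smeasure E2 u ((fun t => `|f2 t|) @^-1` A).
Proof.
move=> mA.
have mn (f : TR -> R) : measurable_fun setT f ->
    measurable_fun setT (fun t => `|f t| : TR).
  by move=> mf; apply: measurableT_comp.
have gE (E : spectral_measure X) (f : TR -> R) (x : R) : measurable_fun setT f ->
    smeasure E u ((fun t => `|f t|) @^-1` `]x, +oo[%classic) =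
    (`|u - E (sublevel f x) u| ^+ 2)%:E.
  move=> mf; have uE := sproj_setC E u (measurable_sublevel x mf).
  rewrite [X in X - _]uE addrAC subrr add0r /smeasure; congr (`|E _ u| ^+ 2)%:E.
  apply/seteqP; split => t /=; rewrite in_itv/= andbT /sublevel/= ltNge.
    by move/negP.
  by move/negP.
pose G := @RGenOInfty.G R.
pose g (n : nat) : set R := `]- n%:R, +oo[%classic.
apply: (@measure_unique _ _ TR G g _ _ _ _
  (pushforward (smeasure E1 u) (fun t => `|f1 t| : TR))
  (pushforward (smeasure E2 u) (fun t => `|f2 t| : TR))) => //.
- exact: RGenOInfty.measurableE.
- move=> _ _ [x ->] [y ->]; exists (Num.max x y); apply/seteqP; split => t /=.
    by rewrite !in_itv/= !andbT gt_max => -[-> ->].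
  by rewrite !in_itv/= !andbT gt_max => /andP.
- by move=> n; exists (- n%:R).
- rewrite -subTset => t _; exists (Num.truncn `|t|).+1 => //=.
  rewrite /g/= in_itv/= andbT ltrNl.
  by apply: le_lt_trans (truncnS_gt _); rewrite -normrN ler_norm.
- exact: mn.
- exact: mn.
- move=> ? ? _ [x ->]; rewrite /= /pushforward.
  by rewrite !gE// sproj_sublevel_eq.
- move=> ? n; apply: (@le_lt_trans _ _ (`|u| ^+ 2)%:E); last exact: ltry.
  apply: smeasure_le_norm; rewrite -[X in measurable X]setTI.
  by apply: (mn _ mf1) => //; exact: measurable_itv.
Qed.

Lemma integral_absf_eq u (h : TR -> R) : measurable_fun setT h ->
  (forall x, 0 <= h x) ->
  (\int[smeasure E1 u]_t (h `|f1 t|%R)%:E = \int[smeasure E2 u]_t (h `|f2 t|%R)%:E)%E.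
Proof.
move=> mh h0.
have mn (f : TR -> R) : measurable_fun setT f ->
    measurable_fun setT (fun t => `|f t| : TR).
  by move=> mf; apply: measurableT_comp.
have push (E : spectral_measure X) (f : TR -> R) : measurable_fun setT f ->
    (\int[smeasure E u]_t (h `|f t|%R)%:E =
     \int[pushforward (smeasure E u) (fun t => `|f t|%R : TR)]_x (h x)%:E)%E.
  move=> mf; rewrite ge0_integral_pushforward//; first exact: mn.
  - by apply/measurable_EFinP.
  - by move=> x _; rewrite lee_fin.
rewrite !push//; apply: eq_measure_integral; [exact: mn|exact: mn|].
by move=> ? ? A mA _; exact: smeasure_absf_eq.
Qed.

End uniqueness.

(** * Index functions and the parameter choice *)

Section index_function_theory.
Context {R : realType}.
Variable phi : R -> R.
Hypothesis phi_index : index_function phi.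

Lemma index_function_small e : 0 < e -> exists2 t0, 0 < t0 &
  forall t, 0 < t -> t <= t0 -> phi t < e.
Proof.
move=> e0; have [phi0 _ nd /cvgrPdist_lt/(_ e e0) lim] := phi_index.
near (0 : R)^'+ => t0.
have t00 : 0 < t0 by [].
exists t0 => // t t0' tt0; apply: le_lt_trans (nd _ _ t0' tt0) _.
have : `|0 - phi t0| < e by near: t0.
by rewrite sub0r normrN; apply: le_lt_trans; exact: ler_norm.
Unshelve. all: by end_near. Qed.

Lemma ext0_nd : {homo ext0 phi : s t / s <= t}.
Proof.
have [phi0 _ nd _] := phi_index; move=> s t st; rewrite /ext0.
have [s0|s0] := ltP 0 s; first by rewrite (lt_le_trans s0 st) nd.
by case: ifP => // t0; rewrite ltW// phi0.
Qed.

Lemma measurable_ext0 : measurable_fun [set: measurableTypeR R] (ext0 phi).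
Proof. by apply: nondecreasing_measurable => // s t; exact: ext0_nd. Qed.

Lemma ext0_le_abs t x : 0 < x -> `|t| <= x -> `|ext0 phi t| <= phi x.
Proof.
have [phi0 _ nd _] := phi_index; move=> x0 tx; rewrite /ext0.
case: ifPn => [t0|_]; last by rewrite normr0 ltW ?phi0.
by rewrite gtr0_norm ?phi0// nd// (le_trans _ tx)// ler_norm.
Qed.

Variable a : R.
Hypothesis a0 : 0 < a.
Let b := a / (2 * a + 2).

Let b0 : 0 < b.
Proof. by rewrite divr_gt0// addr_gt0// mulr_gt0. Qed.

Lemma psi_gt0 t : 0 < t -> 0 < psi a phi t.
Proof.
have [phi0 _ _ _] := phi_index.
by move=> t0; rewrite mulr_gt0 ?phi0 ?powR_gt0.
Qed.

Lemma psi_lt s t : 0 < s -> s < t -> psi a phi s < psi a phi t.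
Proof.
have [phi0 _ nd _] := phi_index; move=> s0 st; have t0 := lt_trans s0 st.
apply: (@le_lt_trans _ _ (phi t * s `^ b)); rewrite /psi -/b.
  by rewrite ler_wpM2r ?powR_ge0// nd// ltW.
by rewrite ltr_pM2l ?phi0// gt0_ltr_powR// nnegrE ltW.
Qed.

(** Near a positive point the power is the composite of exp and ln. *)
Lemma psi_continuous t : 0 < t -> {for t, continuous (psi a phi)}.
Proof.
move=> t0; have [_ phic _ _] := phi_index.
apply: continuousM; first exact: phic.
have c : expR (b * ln s) @[s --> t] --> expR (b * ln t).
  apply: continuous_cvg; first exact: continuous_expR.
  by apply: cvgMr; exact: continuous_ln.
suff : s `^ b @[s --> t] --> t `^ b by [].
rewrite [X in _ --> X]/powR gt_eqF//; apply: cvg_trans c; apply: near_eq_cvg; near=> s.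
by rewrite /powR gt_eqF//; near: s; exact: lt_nbhsr.
Unshelve. all: by end_near. Qed.

(** The intermediate value theorem on [lo, hi]: below, t^b <= 1 and phi is
    small; above, phi is at least phi 1 and t^b is large. *)
Lemma psi_surj d : 0 < d -> exists2 t, 0 < t & psi a phi t = d.
Proof.
move=> d0; have [phi0 _ nd _] := phi_index.
have [t1 t10 t1d] := index_function_small d0.
pose lo := Num.min t1 1; have lo0 : 0 < lo by rewrite lt_min t10 ltr01.
have lo1 : lo <= 1 by rewrite ge_min lexx orbT.
pose hi := Num.max 1 ((d / phi 1) `^ b^-1).
have lohi : lo <= hi by rewrite (le_trans lo1)// le_max lexx.
have psilo : psi a phi lo <= d.
  apply: (@le_trans _ _ (phi lo * 1)); last first.
    by rewrite mulr1 ltW// t1d// ge_min lexx.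
  rewrite ler_wpM2l ?(ltW (phi0 _ lo0))//.
  by rewrite -[leRHS](congr1 (@^~ b) (@powR1 R)) ge0_ler_powR ?nnegrE// ltW.
have psihi : d <= psi a phi hi.
  have dp : 0 <= d / phi 1 by rewrite divr_ge0// ltW// phi0.
  apply: (@le_trans _ _ (phi 1 * (d / phi 1))).
    by rewrite mulrC divfK// gt_eqF// phi0.
  apply: ler_pM => //; first by rewrite ltW// phi0.
    by rewrite nd// le_max lexx.
  have -> : d / phi 1 = ((d / phi 1) `^ b^-1) `^ b.
    by rewrite -powRrM mulVf ?gt_eqF// powRr1.
  rewrite ge0_ler_powR ?nnegrE ?powR_ge0//; first exact: ltW.
    by rewrite le_max ler01.
  by rewrite /hi le_max lexx orbT.
have [||c cin cd] := @IVT R (psi a phi) lo hi d lohi.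
- apply: continuous_subspace_itv => t; rewrite in_itv/= => /andP[lot _].
  by apply: psi_continuous; exact: lt_le_trans lot.
- by rewrite ge_min psilo/= le_max psihi orbT.
by exists c => //; move: cin; rewrite in_itv/= => /andP[loc _]; exact: lt_le_trans loc.
Qed.

Lemma psi_inv_spec d : 0 < d -> 0 < psi_inv a phi d /\ psi a phi (psi_inv a phi d) = d.
Proof.
move=> d0; have [t t0 <-] := psi_surj d0.
have tA : t \in (`]0, +oo[%classic : set R) by rewrite inE/= in_itv/= andbT.
suff inj : {in (`]0, +oo[%classic : set R) &, injective (psi a phi)}.
  by have -> : psi_inv a phi (psi a phi t) = t by exact: pinvKV.
move=> s s'; rewrite !inE/= !in_itv/= !andbT => s0 s'0 ss'.
apply/eqP; case: ltgtP => // h.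
  by have := psi_lt s0 h; rewrite ss' ltxx.
by have := psi_lt s'0 h; rewrite ss' ltxx.
Qed.

Lemma psi_inv_small t0 : 0 < t0 -> \forall d \near 0^'+, psi_inv a phi d < t0.
Proof.
move=> t00; near=> d; have d0 : 0 < d by [].
have [s0 sd] := psi_inv_spec d0.
rewrite ltNge; apply/negP => t0s.
have : psi a phi t0 <= d.
  move: t0s; rewrite le_eqVlt => /predU1P[->|/(psi_lt t00)]; first by rewrite sd.
  by rewrite sd => /ltW.
apply/negP; rewrite -ltNge; near: d.
by apply: nbhs_right_lt; exact: psi_gt0.
Unshelve. all: by end_near. Qed.

End index_function_theory.

(** * Spectral measures bounded away from zero *)

Section range_of_integral.
Context {R : realType} {X : hilbertType R}.
Variable E : spectral_measure X.
Local Notation TR := (measurableTypeR R).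
Implicit Types (u v w : X) (A B : set TR) (f g : TR -> R).

Lemma smeasureN u A : measurable A -> smeasure E (- u)%R A = smeasure E u A.
Proof. by move=> mA; rewrite /smeasure -scaleN1r sprojZ// scaleN1r normrN. Qed.

Lemma energyN f u : energy E f (- u) = energy E f u.
Proof. by apply: eq_measure_integral => A mA _; exact: smeasureN. Qed.

(** The measure of int f dE w has density f^2 with respect to that of w. When f
    is not square integrable the spectral integral is 0 by convention, and the
    inequality still holds. *)
Lemma smeasure_spectral_int f w A : measurable_fun setT f -> measurable A ->
  (smeasure E (spectral_int E f w) A <= \int[smeasure E w]_t (f t ^+ 2 * \1_A t)%:E)%E.
Proof.
move=> mf mA; have [[v fv]|nv] := pselect (exists v, is_spectral_int E f w v).
  rewrite (spectral_int_eq mf fv).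
  rewrite [leLHS](_ : _ = energy E f (E A w)); first exact: energy_sproj_indic.
  by rewrite (is_spectral_int_norm mf (is_spectral_int_sproj mA mf fv)).
rewrite /spectral_int xgetPN; last by move=> v fv; apply: nv; exists v.
rewrite [leLHS](_ : _ = 0%E); last by rewrite /smeasure sprojr0// normr0 expr0n.
by apply: integral_ge0 => t _; rewrite lee_fin mulr_ge0// sqr_ge0.
Qed.

End range_of_integral.

Section bounded_below.
Context {R : realType} {X : hilbertType R}.
Variable E : spectral_measure X.
Local Notation TR := (measurableTypeR R).

(** On the range of E {|t| <= m/2} one has both |B v| <= m/2 |v| and
    |B v| >= m |v|. *)
Lemma bounded_below_sproj0 (D : set X) (B : X -> X) (m : R) :
  spectral_measure_of E D B -> 0 < m -> (forall u, D u -> m * `|u| <= `|B u|) ->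
  forall u, E (sublevel id (m / 2)) u = 0.
Proof.
move=> [DE BE] m0 Bm u.
have mid : measurable_fun [set: TR] (id : TR -> R) by [].
have mA := measurable_sublevel (m / 2) mid.
set A := sublevel _ _ in mA *; set v := E A u.
have m20 : 0 <= m / 2 by rewrite divr_ge0// ltW.
have ev : (energy E id v <= ((m / 2) ^+ 2 * `|v| ^+ 2)%:E)%E by exact: energy_sproj_le.
have vfin : (energy E id v < +oo)%E by apply: le_lt_trans ev (ltry _).
have Dv : D v by rewrite DE.
move: ev; rewrite -spectral_int_norm// -BE// lee_fin => ev.
have := Bm v Dv; rewrite -(@ler_pXn2r _ 2)// ?nnegrE ?mulr_ge0 ?(ltW m0)// exprMn.
move=> /le_trans/(_ ev); rewrite expr_div_n => h.
have m2 : 0 < m ^+ 2 by rewrite exprn_gt0.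
apply/eqP; rewrite -normr_eq0 -sqrf_eq0 eq_le sqr_ge0 andbT.
move: h; set y := `|v| ^+ 2; set x := m ^+ 2 in m2 *; nra.
Qed.

Variable c : R.
Hypotheses (c0 : 0 < c) (Ec : forall u, E (sublevel id c) u = 0).

Let measurable_low : measurable (sublevel id c : set TR).
Proof. exact: measurable_sublevel. Qed.

(** Powers with nonpositive exponent are bounded on |t| > c, so the weak norms
    are finite on the whole space. *)
Lemma energy_powR_fin (tau : R) u : tau <= 0 ->
  (energy E (@powR R ^~ tau) u < +oo)%E.
Proof.
move=> tau0; rewrite -(sproj_compl0 (A := ~` sublevel id c) (E := E) (u := u)).
- apply: (@le_lt_trans _ _ _ _ _ _ (ltry _)).
  apply: (@energy_sproj_le _ _ _ _ _ _ (1 + c `^ tau)).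
  + exact: measurableC.
  + exact: measurable_powR.
  + by rewrite addr_ge0// powR_ge0.
  move=> t /negP; rewrite /sublevel/= -ltNge => ct.
  rewrite ger0_norm ?powR_ge0//.
  have [t0|t0|t0] := ltgtP t 0.
  (* powR is constantly 1 on negative reals *)
  + by rewrite [leLHS]/powR lt_eqF// ln0 ?(ltW t0)// mulr0 expR0 lerDl powR_ge0.
  + have {}ct : c < t by rewrite gtr0_norm in ct.
    apply: (@le_trans _ _ (c `^ tau)); last by rewrite lerDr.
    rewrite -(opprK tau) powRN [leRHS]powRN lef_pV2 ?posrE ?powR_gt0//.
    by apply: ge0_ler_powR; rewrite ?nnegrE ?oppr_ge0// ltW.
  + by move: ct; rewrite t0 normr0 => /(lt_trans c0); rewrite ltxx.
- exact: measurableC.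
- by rewrite setCK.
Qed.

(** A pointwise inequality 1 <= x g^2 + y h^2 integrates to a bound of the norm
    by two weighted norms. It may fail at 0, which E does not charge. *)
Lemma le_normsq_energy (g h : TR -> R) (x y : R) u : 0 <= x -> 0 <= y ->
  measurable_fun setT g -> measurable_fun setT h ->
  (forall t, t != 0 -> 1 <= x * g t ^+ 2 + y * h t ^+ 2) ->
  ((`|u| ^+ 2)%:E <= x%:E * energy E g u + y%:E * energy E h u)%E.
Proof.
move=> x0 y0 mg mh gh; have mC := measurableC measurable_low.
have -> : (`|u| ^+ 2)%:E =
    (\int[smeasure E u]_t (((\1_(~` sublevel id c) t : R)) ^+ 2)%:E)%E.
  under eq_integral => t _.
    have -> : ((\1_(~` sublevel id c) t : R)) ^+ 2 = \1_(~` sublevel id c) t.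
      by rewrite indicE; case: (t \in _); rewrite ?expr1n ?expr0n.
    over.
  have Eu : E (~` sublevel id c) u = u by apply: sproj_compl0; rewrite ?setCK.
  by rewrite integral_indic// setIT -[in LHS]Eu.
apply: le_integral_sqr2 => // t.
rewrite indicE; case: (boolP (t \in _)) => [|_]; last first.
  by rewrite expr0n addr_ge0// mulr_ge0// sqr_ge0.
rewrite inE /sublevel/= => /negP; rewrite -ltNge expr1n => ct; apply: gh.
by rewrite -normr_gt0 (lt_trans c0).
Qed.

End bounded_below.

(** * The spectral cutoff of an element satisfying a source condition *)

Section cutoff.
Context {R : realType} {X : hilbertType R}.
Local Notation TR := (measurableTypeR R).

Lemma integral_smeasure_le (E : spectral_measure X) w (f : TR -> R) (K : R) :
  measurable_fun setT f -> (forall t, 0 <= f t <= K) ->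
  (\int[smeasure E w]_t (f t)%:E <= (K * `|w| ^+ 2)%:E)%E.
Proof.
move=> mf fK; rewrite EFinM -(smeasureT E) -(integral_cst (smeasure E w) measurableT).
apply: ge0_le_integral => //.
- by move=> t _; rewrite lee_fin; case/andP: (fK t).
- by apply/measurable_EFinP.
by move=> t _; rewrite lee_fin; case/andP: (fK t).
Qed.

Variables (E EG : spectral_measure X) (T : X -> X) (a : R).
Hypothesis a0 : 0 < a.
Let g (t : TR) : R := t `^ (- (2 * a + 2)).
Hypotheses (TE : everywhere_spectral_int E g T) (TG : everywhere_spectral_int EG id T).
Variables (phi : R -> R) (w : X).
Hypothesis phi_index : index_function phi.
Let p := spectral_int EG (ext0 phi) w.
Let eta := (2 * a + 2)^-1.
Let b := a / (2 * a + 2).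

Let e0 : 0 < 2 * a + 2. Proof. by rewrite addr_gt0// mulr_gt0. Qed.
Let eta0 : 0 < eta. Proof. by rewrite invr_gt0. Qed.
Let b0 : 0 < b. Proof. by rewrite divr_gt0. Qed.

Let mg : measurable_fun setT g. Proof. exact: measurable_powR. Qed.
Let mid : measurable_fun [set: TR] (id : TR -> R). Proof. by []. Qed.
Let mphi := measurable_ext0 phi_index.

Let g_ge0 t : 0 <= g t. Proof. exact: powR_ge0. Qed.

Let powR_gE t tau : t `^ tau = g t `^ (- tau / (2 * a + 2)).
Proof. by rewrite /g -powRrM; congr (_ `^ _); field; rewrite gt_eqF. Qed.

(** The projection is transported from E to EG, where p has density (ext0 phi)^2
    with respect to w, and ext0 phi is at most phi alpha on [-alpha, alpha]. *)
Lemma cutoff_low_norm (alpha : R) : 0 < alpha ->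
  `|E (sublevel g alpha) p| <= phi alpha * `|w|.
Proof.
move=> al0; have [phi0 _ _ _] := phi_index.
rewrite (sproj_sublevel_eq mg mid TE TG).
have mA := measurable_sublevel alpha mid; set A := sublevel id alpha in mA *.
rewrite -(@ler_pXn2r _ 2)// ?nnegrE ?mulr_ge0 ?(ltW (phi0 _ _))// -lee_fin.
apply: le_trans (smeasure_spectral_int EG w mphi mA) _.
rewrite exprMn; apply: integral_smeasure_le.
  by apply: measurable_funM => //; exact: measurable_funX.
move=> t; rewrite mulr_ge0 ?sqr_ge0//= indicE.
case: (boolP (t \in A)) => [|_]; last by rewrite mulr0 sqr_ge0.
rewrite inE /A /sublevel/= => tal; rewrite mulr1 -real_normK ?num_real//.
rewrite lerXn2r ?nnegrE ?(ltW (phi0 _ _))//; exact: ext0_le_abs.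
Qed.

(** B^-a = G^b, and G is at most alpha on the range of the projection. *)
Lemma cutoff_low_weak (u : X) (alpha : R) : 0 < alpha ->
  (energy E (@powR R ^~ (- a)%R) (E (sublevel g alpha) u) <=
   ((alpha `^ b) ^+ 2 * `|E (sublevel g alpha) u| ^+ 2)%:E)%E.
Proof.
move=> al0; apply: energy_sproj_le.
- exact: measurable_sublevel.
- exact: measurable_powR.
- exact: powR_ge0.
move=> t; rewrite /sublevel/= ger0_norm ?g_ge0// => gt.
rewrite ger0_norm ?powR_ge0// powR_gE opprK.
by apply: ge0_ler_powR; rewrite ?nnegrE// ltW.
Qed.

(** B = G^-eta, so the left side is the integral of |t|^(-2 eta) over |t| > alpha
    for the measure EG of p. For |t| < t0 the density phi^2 turns the integrand
    into (phi(|t|)/|t|^eta)^2, which the quotient condition bounds by its value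
    at alpha. For |t| >= t0 the weight is at most t0^(-2 eta): this constant
    contribution is harmless, since phi(alpha)/alpha^eta is bounded below for
    small alpha. *)
Lemma cutoff_high_strong (alpha t0 : R) : 0 < alpha -> alpha < t0 ->
  (forall s t, 0 < s -> s < t -> t < t0 ->
    s `^ eta / phi s < t `^ eta / phi t) ->
  (energy E (@powR R ^~ 1%R) (E (~` sublevel g alpha) p) <=
   ((phi alpha / alpha `^ eta) ^+ 2 * `|w| ^+ 2 +
    (t0 `^ eta)^-1 ^+ 2 * `|p| ^+ 2)%:E)%E.
Proof.
move=> al0 alt0 incr; have [phi0 _ _ _] := phi_index.
have t00 := lt_trans al0 alt0.
have mA := measurable_sublevel alpha mg; have mC := measurableC mA.
pose h (x : TR) : R := (x `^ (- eta)) ^+ 2 * \1_(`]alpha, +oo[%classic : set TR) x.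
pose h1 (x : TR) : R := (x `^ (- eta)) ^+ 2 * \1_(`]alpha, t0[%classic : set TR) x.
have mh2 : measurable_fun [set: TR] (fun x : TR => (x `^ (- eta)) ^+ 2 : R).
  by apply: measurable_funX; exact: measurable_powR.
have mh : measurable_fun setT h.
  by apply: measurable_funM => //; apply: measurable_indic; exact: measurable_itv.
have mh1 : measurable_fun setT h1.
  by apply: measurable_funM => //; apply: measurable_indic; exact: measurable_itv.
have h0 x : 0 <= h x by rewrite mulr_ge0 ?sqr_ge0.
have h10 x : 0 <= h1 x by rewrite mulr_ge0 ?sqr_ge0.
apply: le_trans (energy_sproj_indic _ _ mC _) _; first exact: measurable_powR.
have -> : (\int[smeasure E p]_t ((t `^ 1) ^+ 2 * \1_(~` sublevel g alpha) t)%:E =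
    \int[smeasure E p]_t (h `|g t|%R)%:E)%E.
  apply: eq_integral => t _; congr EFin; rewrite /h ger0_norm ?g_ge0//.
  rewrite powR_gE mulN1r; congr (_ * _); rewrite !indicE.
  congr ((_ : bool)%:R); apply/idP/idP; rewrite !inE /sublevel/= in_itv/= andbT.
    by move=> /negP; rewrite -ltNge ger0_norm ?g_ge0.
  by move=> h'; apply/negP; rewrite -ltNge ger0_norm ?g_ge0.
rewrite (integral_absf_eq mg mid TE TG)//.
have mnorm : measurable_fun [set: TR] (fun t : TR => `|t| : TR).
  by apply: measurableT_comp.
have mh1n : measurable_fun [set: TR] (fun t : TR => h1 `|t| : R).
  by apply: (measurableT_comp mh1 mnorm).
apply: (@le_trans _ _ (\int[smeasure EG p]_t ((h1 `|t|%R)%:E +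
  ((t0 `^ eta)^-1 ^+ 2)%:E))%E).
  apply: ge0_le_integral => //.
  - by move=> t _; rewrite lee_fin.
  - by apply/measurable_EFinP; apply: (measurableT_comp mh mnorm).
  - by apply: emeasurable_funD => //; apply/measurable_EFinP.
  move=> t _; rewrite -EFinD lee_fin /h /h1 !indicE.
  have [|xt0] := ltP `|t| t0.
    move=> xt0; rewrite !mem_setE !in_itv/= xt0 !andbT lerDl sqr_ge0//.
  rewrite -[leLHS]add0r; apply: lerD; first by rewrite mulr_ge0 ?sqr_ge0.
  apply: (@le_trans _ _ ((`|t| `^ (- eta)) ^+ 2)).
    by rewrite ler_piMr ?sqr_ge0//; case: (_ \in _).
  rewrite lerXn2r ?nnegrE ?powR_ge0 ?invr_ge0 ?powR_ge0//.
  rewrite powRN lef_pV2 ?posrE ?powR_gt0//; last exact: lt_le_trans xt0.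
  by apply: ge0_ler_powR; rewrite ?nnegrE// ltW.
rewrite ge0_integralD//; last 3 first.
- by move=> t _; rewrite lee_fin.
- by apply/measurable_EFinP.
- by move=> t _; rewrite lee_fin sqr_ge0.
rewrite integral_cst// EFinD; apply: leeD; last first.
  by rewrite [leRHS]EFinM -(smeasureT EG).
have mphi2 : measurable_fun [set: TR] (fun t => ext0 phi t ^+ 2).
  exact: measurable_funX.
apply: (@le_trans _ _ (\int[smeasure EG w]_t (h1 `|t|%R * ext0 phi t ^+ 2)%:E)%E).
  apply: (@le_integral_density _ _ (smeasure EG p) (fun t => ext0 phi t ^+ 2)
    _ _ _ (fun t => h1 `|t|)) => //.
  - by move=> t; exact: sqr_ge0.
  - move=> B mB; apply: le_trans (smeasure_spectral_int EG w mphi mB) _.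
    rewrite [leRHS]integral_mkcond le_eqVlt; apply/orP; left; apply/eqP.
    apply: eq_integral => t _; rewrite /patch indicE.
    by case: ifP => _; rewrite ?mulr1 ?mulr0.
apply: integral_smeasure_le; first exact: measurable_funM.
move=> t; rewrite mulr_ge0 ?sqr_ge0//= /h1 indicE mem_setE in_itv/=.
have [/andP[alt tt0]|_] := boolP (_ && _); last by rewrite mulr0 mul0r sqr_ge0.
have t0' := lt_trans al0 alt.
rewrite mulr1 -exprMn -[leLHS]real_normK ?num_real// lerXn2r ?nnegrE//.
  by rewrite divr_ge0 ?powR_ge0// ltW// phi0.
rewrite normrM ger0_norm ?powR_ge0//.
apply: (@le_trans _ _ (`|t| `^ (- eta) * phi `|t|)).
  by rewrite ler_wpM2l ?powR_ge0// ext0_le_abs.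
rewrite powRN mulrC -(invf_div (`|t| `^ eta)) -(invf_div (alpha `^ eta)).
by rewrite lef_pV2 ?posrE ?divr_gt0 ?powR_gt0 ?phi0// ltW// incr.
Qed.

End cutoff.

(** * Interpolation and the error of Tikhonov regularization *)

Section interpolation.
Context {R : realType}.

(** With x = t^-(2a+2), so that t^-a = x^b and t^1 = x^-eta, the first term is
    (x/alpha)^(2b) and the second (x/alpha)^(-2 eta): one of them is at least 1
    according to whether x >= alpha. *)
Lemma interpolation_pointwise (a alpha t : R) : 0 < a -> 0 < alpha -> t != 0 ->
  1 <= (alpha `^ (a / (2 * a + 2))) ^- 2 * (t `^ (- a)) ^+ 2 +
       (alpha `^ (2 * a + 2)^-1) ^+ 2 * (t `^ 1) ^+ 2.
Proof.
move=> a0 al0 t0; have e0 : 0 < 2 * a + 2 by rewrite addr_gt0// mulr_gt0.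
set eta := (2 * a + 2)^-1; set b := a / _.
have eta0 : 0 <= eta by rewrite invr_ge0 ltW.
have b0 : 0 <= b by rewrite divr_ge0// ltW.
pose x := t `^ (- (2 * a + 2)).
have x0 : 0 < x by rewrite /x /powR (negbTE t0) expR_gt0.
have -> : t `^ (- a) = x `^ b.
  by rewrite /x -powRrM; congr (_ `^ _); rewrite /b; field; rewrite gt_eqF.
have -> : t `^ 1 = (x `^ eta)^-1.
  by rewrite /x -powRN -powRrM; congr (_ `^ _); rewrite /eta; field; rewrite gt_eqF.
clearbody x; have [alx|xal] := leP alpha x.
  rewrite -[leLHS]addr0; apply: lerD; last by rewrite mulr_ge0// sqr_ge0.
  rewrite mulrC ler_pdivlMr ?exprn_gt0 ?powR_gt0// mul1r.
  by rewrite lerXn2r ?nnegrE ?powR_ge0// ge0_ler_powR ?nnegrE// ltW.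
rewrite -[leLHS]add0r; apply: lerD.
  by rewrite mulr_ge0 ?sqr_ge0// invr_ge0 sqr_ge0.
rewrite exprVn ler_pdivlMr ?exprn_gt0 ?powR_gt0// mul1r.
by rewrite lerXn2r ?nnegrE ?powR_ge0// ge0_ler_powR ?nnegrE// ltW.
Qed.

(** a/(2a+2) + 1/(2a+2) = 1/2: the scaling identity that balances the two terms
    of the Tikhonov functional. *)
Lemma powR_half_split (a alpha : R) : 0 < a -> 0 < alpha ->
  alpha = (alpha `^ (a / (2 * a + 2)) * alpha `^ (2 * a + 2)^-1) ^+ 2.
Proof.
move=> a0 al0; have e0 : 0 < 2 * a + 2 by rewrite addr_gt0// mulr_gt0.
rewrite -powRD ?(gt_eqF al0) ?implybT// -powR_mulrn ?powR_ge0// -powRrM.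
rewrite (_ : _ * _ = 1) ?powRr1 ?(ltW al0)//; field; rewrite gt_eqF//.
Qed.

Context {X : hilbertType R} (E : spectral_measure X).

Lemma snormE tau u : (energy E (@powR R ^~ tau) u < +oo)%E ->
  (snorm E tau u ^+ 2)%:E = energy E (@powR R ^~ tau) u.
Proof. by move=> h; apply: spectral_int_norm => //; exact: measurable_powR. Qed.

Lemma sspace1P u : sspace E 1 u <-> (energy E (@powR R ^~ 1%R) u < +oo)%E.
Proof. by rewrite /sspace ltr01. Qed.

Lemma snormD_sqr tau u v : (energy E (@powR R ^~ tau) u < +oo)%E ->
  (energy E (@powR R ^~ tau) v < +oo)%E ->
  (energy E (@powR R ^~ tau) (u + v)%R < +oo)%E /\
  snorm E tau (u + v) ^+ 2 <= 2 * snorm E tau u ^+ 2 + 2 * snorm E tau v ^+ 2.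
Proof.
move=> hu hv.
have := energyD_le E u v (measurable_powR tau); rewrite -(snormE hu) -(snormE hv).
rewrite -!EFinM -EFinD => h; have huv := le_lt_trans h (ltry _); split => //.
by rewrite -lee_fin snormE.
Qed.

Lemma snormN tau u : (energy E (@powR R ^~ tau) u < +oo)%E ->
  snorm E tau (- u) = snorm E tau u.
Proof.
move=> hu; apply/eqP; rewrite -(@eqrXn2 _ 2) ?normr_ge0//; apply/eqP.
apply: EFin_inj; have hNu := hu; rewrite -energyN in hNu.
by rewrite (snormE hNu) (snormE hu) energyN.
Qed.

End interpolation.

Lemma le_sqr_succ (R : realType) (x : R) : 0 <= x -> x <= (x + 1) ^+ 2.
Proof. by move=> x0; nra. Qed.

(** The deterministic core, for one regularization parameter: if udag - ubar
    splits into a smooth part r and a remainder q that are small relative to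
    delta = ph alpha^b, then ubar + r competes with the minimizer u in the
    Tikhonov functional, and the interpolation inequality turns the resulting
    bounds in the weak and the strong norm into |u - udag| = O(ph). *)
Lemma tikhonov_error (R : realType) (X Y : hilbertType R)
  (E : spectral_measure X) (c : R) (DF : set X) (F : X -> Y)
  (udag ubar q r u : X) (fdag f : Y) (a ca Ca alpha delta ph W K M : R) :
  0 < c -> (forall u, E (sublevel id c) u = 0) ->
  0 < a -> 0 < ca -> ca <= Ca -> 0 < alpha -> 0 < ph -> 0 <= W -> 0 <= K ->
  (forall v, (DF `&` sspace E 1) v ->
    ca * snorm E (- a) (v - udag) <= `|F v - fdag| /\
    `|F v - fdag| <= Ca * snorm E (- a) (v - udag)) ->
  `|f - fdag| <= delta ->
  delta = ph * alpha `^ (a / (2 * a + 2)) ->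
  tikhonov_minimizer E F ubar DF f alpha u ->
  sspace E 1 ubar -> sspace E 1 r ->
  udag - ubar = r + q -> DF (ubar + r) ->
  `|q| <= W * ph -> snorm E (- a) q <= W * delta ->
  alpha * snorm E 1 r ^+ 2 <= K * delta ^+ 2 ->
  M = (Ca * W + 1) ^+ 2 + K ->
  `|u - udag| <= (2 * (((M + 2) / ca) ^+ 2 + W ^+ 2) + 2 * (M + K) + 1 + W) * ph.
Proof.
move=> c0 Ec a0 ca0 caCa al0 ph0 W0 K0 Fb fd dE [DFu umin] barX rX pE DFr qn qa r1 ME.
have dual v : (energy E (@powR R ^~ (- a)%R) v < +oo)%E.
  by apply: (energy_powR_fin c0 Ec); rewrite oppr_le0 ltW.
have /sspace1P hr := rX; have /sspace1P hbar := barX.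
have /sspace1P halpha : sspace E 1 (ubar + r).
  by apply/sspace1P; have [] := snormD_sqr hbar hr.
have d0 : 0 < delta by rewrite dE mulr_gt0// powR_gt0.
have Ca0 : 0 < Ca := lt_le_trans ca0 caCa.
have rE : ubar + r - ubar = r by rewrite addrC addrA addNr add0r.
have qE : ubar + r - udag = - q.
  by rewrite -(subrK ubar udag) pE; apply/eqP; rewrite subr_eq; apply/eqP;
    rewrite [r + q]addrC -addrA addKr addrC.
have rX' : ubar + r \in sspace E 1 by rewrite inE; apply/sspace1P.
move: (umin _ DFr); rewrite /tikhonov rX'.
case: ifPn => [|_]; last by rewrite leye_eq.
rewrite inE => uX; have /sspace1P hu := uX; rewrite lee_fin rE => minineq.
have huu : (energy E (@powR R ^~ 1%R) (u - ubar)%R < +oo)%E.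
  have hN : (energy E (@powR R ^~ 1%R) (- ubar)%R < +oo)%E by rewrite energyN.
  by have [] := snormD_sqr hu hN.
have FM : `|F (ubar + r) - f| <= (Ca * W + 1) * delta.
  have -> : F (ubar + r) - f = (F (ubar + r) - fdag) - (f - fdag).
    by rewrite opprB addrA subrK.
  apply: le_trans (ler_normB _ _) _; rewrite mulrDl mul1r; apply: lerD => //.
  have [_ /le_trans->//] := Fb (ubar + r) (conj DFr ((sspace1P E _).2 halpha)).
  by rewrite qE snormN// -mulrA ler_pM2l.
have total : `|F u - f| ^+ 2 + alpha * snorm E 1 (u - ubar) ^+ 2 <= M * delta ^+ 2.
  apply: le_trans minineq _; rewrite ME mulrDl; apply: lerD => //.
  by rewrite -exprMn lerXn2r ?nnegrE// mulr_ge0// ?addr_ge0// ?mulr_ge0// ltW.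
have M0 : 0 <= M by rewrite ME addr_ge0// sqr_ge0.
have strong : alpha * snorm E 1 (u - ubar) ^+ 2 <= M * delta ^+ 2.
  by apply: le_trans total; rewrite lerDr sqr_ge0.
have Fuf : `|F u - f| <= (M + 1) * delta.
  rewrite -(@ler_pXn2r _ 2)// ?nnegrE ?mulr_ge0 ?addr_ge0 ?(ltW d0)// exprMn.
  apply: (@le_trans _ _ (M * delta ^+ 2)).
    by apply: le_trans total; rewrite lerDl mulr_ge0 ?sqr_ge0 ?ltW.
  by rewrite ler_wpM2r ?sqr_ge0// le_sqr_succ.
have weak : snorm E (- a) (u - udag) <= (M + 2) / ca * delta.
  rewrite mulrAC ler_pdivlMr// mulrC.
  have [/le_trans->//] := Fb u (conj DFu uX).
  have -> : F u - fdag = (F u - f) + (f - fdag) by rewrite addrA subrK.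
  by apply: le_trans (ler_normD _ _) _; lra.
pose v := u - (ubar + r).
have vE1 : v = (u - udag) + q by rewrite /v -[q]opprK -qE opprB addrA subrK.
have vE2 : v = (u - ubar) + - r by rewrite /v opprD addrA.
have hNr : (energy E (@powR R ^~ 1%R) (- r)%R < +oo)%E by rewrite energyN.
have [_ va] := snormD_sqr (dual (u - udag)) (dual q); rewrite -vE1 in va.
have [hv v1] := snormD_sqr huu hNr; rewrite -vE2 snormN// in hv v1.
set B := alpha `^ (a / (2 * a + 2)) in dE.
pose H := alpha `^ (2 * a + 2)^-1.
have B0 : 0 < B by rewrite powR_gt0.
have H0 : 0 < H by rewrite powR_gt0.
have alE : alpha = (B * H) ^+ 2 by exact: powR_half_split.
have : ((`|v| ^+ 2)%:E <= ((B ^- 2)%:E * energy E (@powR R ^~ (- a)%R) v +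
    (H ^+ 2)%:E * energy E (@powR R ^~ 1%R) v))%E.
  apply: (le_normsq_energy c0 Ec); rewrite ?invr_ge0 ?sqr_ge0//.
  by move=> t; exact: interpolation_pointwise.
rewrite -(snormE (dual v)) -(snormE hv) -!EFinM -EFinD lee_fin => vle.
have {}vle : `|v| ^+ 2 <= (2 * (((M + 2) / ca) ^+ 2 + W ^+ 2) + 2 * (M + K)) * ph ^+ 2.
  have ler0n2 : 0 <= 2 :> R by [].
  have wa : snorm E (- a) v ^+ 2 <=
      2 * (((M + 2) / ca) ^+ 2 + W ^+ 2) * (ph * B) ^+ 2.
    have w' : snorm E (- a) (u - udag) ^+ 2 <= (((M + 2) / ca) * delta) ^+ 2.
      have Mca : 0 <= (M + 2) / ca by rewrite divr_ge0 ?addr_ge0// ltW.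
      by apply: lerXn2r => //; rewrite nnegrE ?normr_ge0// mulr_ge0// ltW.
    have q' : snorm E (- a) q ^+ 2 <= (W * delta) ^+ 2.
      by apply: lerXn2r => //; rewrite nnegrE ?normr_ge0// mulr_ge0// ltW.
    apply: le_trans va _.
    apply: le_trans (lerD (ler_wpM2l ler0n2 w') (ler_wpM2l ler0n2 q')) _.
    by rewrite -dE -mulrDr -[leRHS]mulrA ler_pM2l// !exprMn -mulrDl.
  have w1 : (B * H) ^+ 2 * snorm E 1 v ^+ 2 <= 2 * (M + K) * (ph * B) ^+ 2.
    rewrite -alE -dE; apply: le_trans (ler_wpM2l (ltW al0) v1) _.
    apply: le_trans (_ : 2 * (M * delta ^+ 2) + 2 * (K * delta ^+ 2) <= _).
      rewrite mulrDr mulrCA [X in _ + X <= _]mulrCA.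
      exact: lerD (ler_wpM2l ler0n2 strong) (ler_wpM2l ler0n2 r1).
    by rewrite -mulrDr -mulrDl mulrA.
  apply: le_trans vle _; rewrite mulrDl; apply: lerD.
    by rewrite mulrC ler_pdivrMr ?exprn_gt0// -[leRHS]mulrA -exprMn.
  rewrite -(@ler_pM2l _ (B ^+ 2)) ?exprn_gt0// mulrA -exprMn.
  by apply: le_trans w1 _; rewrite le_eqVlt; apply/orP; left; apply/eqP; ring.
set C := _ + 2 * (M + K) in vle *.
have C0 : 0 <= C.
  by rewrite /C addr_ge0// mulr_ge0// addr_ge0// sqr_ge0.
clearbody C; have vn : `|v| <= (C + 1) * ph.
  rewrite -(@ler_pXn2r _ 2)// ?nnegrE ?mulr_ge0 ?addr_ge0 ?(ltW ph0)// exprMn.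
  by apply: le_trans vle _; rewrite ler_wpM2r ?sqr_ge0// le_sqr_succ.
have -> : u - udag = v - q by rewrite vE1 addrK.
by apply: le_trans (ler_normB _ _) _; rewrite [leRHS]mulrDl lerD.
Qed.

(** * The convergence rate *)

Theorem corollary5p4
  (R : realType) (X Y : hilbertType R)
  (hX : infinite_dim X) (hY : infinite_dim Y)
  (* the operator B and its spectral measure *)
  (DB : set X) (B : X -> X)
  (B_sa : self_adjoint DB B) (B_pos : positive_definite DB B)
  (B_unbounded : unbounded DB B)
  (m : R) (m_gt0 : 0 < m) (B_ge : forall u, DB u -> m * `|u| <= `|B u|)
  (E : spectral_measure X) (hE : spectral_measure_of E DB B)
  (* the forward operator *)
  (DF : set X) (F : X -> Y)
  (F_wcont : weak_seq_continuous DF F)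
  (DF_closed : closed DF) (DF_convex : convex_set DF)
  (D_neq0 : DF `&` sspace E 1 !=set0)
  (udag : X) (fdag : Y) (F_udag : F udag = fdag) (udag_int : DF° udag)
  (ubar : X) (ubar_D : (DF `&` sspace E 1) ubar)
  (a ca Ca : R) (a_gt0 : 0 < a) (ca_gt0 : 0 < ca) (caCa : ca <= Ca)
  (F_bounds : forall u, (DF `&` sspace E 1) u ->
    ca * snorm E (- a) (u - udag) <= `|F u - fdag| /\
    `|F u - fdag| <= Ca * snorm E (- a) (u - udag))
  (* the spectral measure of G = B ^ (- (2 a + 2)) *)
  (EG : spectral_measure X)
  (hEG : spectral_measure_of EG setT (spow E (- (2 * a + 2))))
  (* the source condition *)
  (phi : R -> R) (phi_index : index_function phi)
  (phi_quot : quotient_increasing phi)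
  (source : exists w : X, udag - ubar = spectral_int EG (ext0 phi) w)
  (* the noisy data and the regularized solutions *)
  (fdelta : R -> Y)
  (fdeltaP : forall delta : R, 0 < delta -> `|fdelta delta - fdag| <= delta)
  (udelta : R -> X)
  (udeltaP : forall delta : R, 0 < delta ->
    tikhonov_minimizer E F ubar DF (fdelta delta) (psi_inv a phi delta)
      (udelta delta)) :
  exists2 C : R, 0 < C & \forall delta \near 0^'+,
    `|udelta delta - udag| <= C * phi (psi_inv a phi delta).
Proof.
have Ec := bounded_below_sproj0 hE m_gt0 B_ge.
have c0 : 0 < m / 2 by rewrite divr_gt0.
have e0 : 0 < 2 * a + 2 by rewrite addr_gt0// mulr_gt0.
have eta0 : 0 < (2 * a + 2)^-1 by rewrite invr_gt0.
(* Both E and EG represent B ^ (- (2 a + 2)). *)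
have TE : everywhere_spectral_int E (@powR R ^~ (- (2 * a + 2))) (spow E (- (2 * a + 2))).
  by move=> u; split => //; apply: (energy_powR_fin c0 Ec); rewrite oppr_le0 ltW.
have TG : everywhere_spectral_int EG id (spow E (- (2 * a + 2))).
  case: hEG => domE GE u; split; last exact: GE.
  by have : [set: X] u by []; rewrite domE.
have [w pE] := source; set p := spectral_int EG (ext0 phi) w in pE.
have [phi0 _ _ _] := phi_index.
have [t0 t00 incr] := phi_quot _ eta0.
set eta := (2 * a + 2)^-1 in eta0 incr.
pose t1 := t0 / 2.
have t10 : 0 < t1 by rewrite divr_gt0.
have t1t0 : t1 < t0 by rewrite ltr_pdivrMr// mulr_natr mulr2n ltrDl.
(* A lower bound of phi alpha / alpha `^ eta for small alpha; it absorbs the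
   constant J contributed by the part of the spectrum of G above t0. *)
pose k := phi t1 / t1 `^ eta.
have k0 : 0 < k by rewrite divr_gt0 ?phi0 ?powR_gt0.
have kle alpha : 0 < alpha -> alpha < t1 -> k <= phi alpha / alpha `^ eta.
  move=> al0 alt1; rewrite -(invf_div (alpha `^ eta)) /k -(invf_div (t1 `^ eta)).
  by rewrite lef_pV2 ?posrE ?divr_gt0 ?powR_gt0 ?phi0// ltW// incr.
pose J := (t0 `^ eta)^-1 ^+ 2 * `|p| ^+ 2.
have J0 : 0 <= J by rewrite mulr_ge0 ?sqr_ge0.
pose K := `|w| ^+ 2 + J / k ^+ 2.
have K0 : 0 <= K by rewrite addr_ge0 ?sqr_ge0// divr_ge0 ?sqr_ge0.
have [rho /= rho0 ball_DF] : exists2 rho, 0 < rho & ball udag rho `<=` DF.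
  by move: udag_int => /nbhs_ballP[rho rho0 h]; exists rho.
have W1 : 0 < `|w| + 1 by rewrite ltr_pwDr.
have [t2 t20 phi_small] := index_function_small phi_index (divr_gt0 rho0 W1).
pose M := (Ca * `|w| + 1) ^+ 2 + K.
exists (2 * (((M + 2) / ca) ^+ 2 + `|w| ^+ 2) + 2 * (M + K) + 1 + `|w|).
  have := sqr_ge0 ((M + 2) / ca); have := sqr_ge0 `|w|; have := normr_ge0 w.
  have : 0 <= M by rewrite addr_ge0 ?sqr_ge0.
  by move: K0; lra.
near=> delta.
have d0 : 0 < delta by [].
have [al0 psial] := psi_inv_spec phi_index a_gt0 d0.
have alt1 : psi_inv a phi delta < t1 by near: delta; exact: psi_inv_small.
have alt2 : psi_inv a phi delta <= t2.
  by apply/ltW; near: delta; exact: psi_inv_small.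
have umin := udeltaP delta d0.
set alpha := psi_inv a phi delta in al0 psial alt1 alt2 umin *; clearbody alpha.
pose S := sublevel (@powR R ^~ (- (2 * a + 2))) alpha.
have mg : measurable_fun setT (@powR R ^~ (- (2 * a + 2))) by exact: measurable_powR.
have mS : measurable S by exact: measurable_sublevel.
have qn : `|E S p| <= `|w| * phi alpha.
  by rewrite [leRHS]mulrC; exact: (cutoff_low_norm TE TG w phi_index al0).
have qrE : udag - ubar = E (~` S) p + E S p by rewrite pE addrC; exact: sproj_setC.
have B0 := powR_gt0 (a / (2 * a + 2)) al0.
have H0 := powR_gt0 eta al0.
have high := cutoff_high_strong a_gt0 TE TG w phi_index al0 (lt_trans alt1 t1t0) incr.
have rfin := le_lt_trans high (ltry _).
have [DFbar barX] := ubar_D.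
apply: (@tikhonov_error _ _ _ E (m / 2) DF F udag ubar (E S p) (E (~` S) p) _ fdag
  (fdelta delta) a ca Ca alpha delta (phi alpha) `|w| K M) => //.
- exact: phi0.
- exact: fdeltaP.
- exact/sspace1P.
- apply: ball_DF; rewrite -ball_normE/=.
  have -> : udag - (ubar + E (~` S) p) = E S p by rewrite opprD addrA qrE addrAC subrr add0r.
  apply: le_lt_trans qn _; have := phi_small _ al0 alt2.
  rewrite ltr_pdivlMr//; apply: le_lt_trans.
  by rewrite mulrC ler_wpM2l ?lerDl// ltW// phi0.
- rewrite -(@ler_pXn2r _ 2)// ?nnegrE ?normr_ge0 ?mulr_ge0 ?(ltW d0)//.
  rewrite -lee_fin snormE; last first.
    by apply: (energy_powR_fin c0 Ec); rewrite oppr_le0 ltW.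
  apply: le_trans (cutoff_low_weak E a_gt0 p al0) _.
  rewrite lee_fin -exprMn lerXn2r ?nnegrE ?mulr_ge0 ?powR_ge0 ?(ltW d0)//.
  by rewrite -psial /psi mulrA mulrC ler_pM2r.
have sr : snorm E 1 (E (~` S) p) ^+ 2 <= K * (phi alpha / alpha `^ eta) ^+ 2.
  rewrite -lee_fin snormE//; apply: le_trans high _; rewrite lee_fin -/J.
  rewrite /K [leRHS]mulrDl [leLHS]addrC [leRHS]addrC; apply: lerD; last by rewrite mulrC.
  rewrite mulrAC ler_pdivlMr ?exprn_gt0// ler_wpM2l//.
  by rewrite lerXn2r ?nnegrE ?kle ?(ltW k0)// divr_ge0 ?powR_ge0// ltW// phi0.
rewrite [X in X * _](powR_half_split a_gt0 al0) -/eta.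
apply: le_trans (ler_wpM2l (sqr_ge0 _) sr) _.
rewrite -psial /psi le_eqVlt; apply/orP; left; apply/eqP; field.
by rewrite gt_eqF.
Unshelve. all: by end_near. Qed.
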